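(* Let $r \ge 3$. There exists $t_0=t_0(r)$ such that for every integer $t\ge t_0$, every $r$-graph $G$ with $\binom{t}{r} - \binom{t-2}{r-2}$ edges satisfies $\lambda(G) \le \lambda([t-1]^{(r)})$.
   Context: An $r$-graph is a finite family of $r$-subsets of $\mathbb{N}$; $[t-1]^{(r)}$ is the complete $r$-graph consisting of all $r$-subsets of $\{1,\dots,t-1\}$. A weighting of $\mathbb{N}$ is $w:\mathbb{N}\to[0,\infty)$ with $\sum_x w(x)=1$; $w(G)=\sum_{e\in G}\prod_{x\in e}w(x)$; the Lagrangian is $\lambda(G)=\max_w w(G)$. *)

(* Defs.v *)
From HB Require Import structures.
From mathcomp Require Import all_boot all_order all_algebra.
From mathcomp Require Import finmap.
From mathcomp Require Import all_classical all_reals all_analysis.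
Set Implicit Arguments. Unset Strict Implicit. Unset Printing Implicit Defensive.
Import Order.TTheory GRing.Theory Num.Theory.
Local Open Scope fset_scope.
Local Open Scope ring_scope.
Import numFieldNormedType.Exports.

Definition is_rgraph (r : nat) (G : {fset {fset nat}}) : Prop :=
  forall e, e \in G -> #|` e| = r.

Definition complete_rgraph (n r : nat) : {fset {fset nat}} :=
  [fset A in fpowerset [fset x | x in iota 1 n] | #|` A| == r].

Definition weighting (R : realType) (w : nat -> R) : Prop :=
  (forall x, 0 <= w x) /\ (series w @ \oo --> (1 : R))%classic.

Definition wgraph (R : realType) (w : nat -> R) (G : {fset {fset nat}}) : R :=
  \sum_(e <- G) \prod_(x <- e) w x.

(* Lagrangian: supremum (in fact maximum) of w(G) over weightings. *)
Definition lagrangian (R : realType) (G : {fset {fset nat}}) : R :=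
  sup [set wgraph w G | w in [set w : nat -> R | weighting w]]%classic.

(* Main.v *)
Require Import Defs.
From HB Require Import structures.
From mathcomp Require Import all_boot all_order all_algebra.
From mathcomp Require Import ring lra zify.
Set Implicit Arguments. Unset Strict Implicit. Unset Printing Implicit Defensive.
Import Order.TTheory GRing.Theory Num.Theory.

(** Let [lam] be the value C(t-1,r)/(t-1)^r of the complete r-graph on t-1 vertices, and
let G carry a weighting with total weight 1 on a finite vertex set V.

If |V| > t and w(G) > lam, some vertex i can be deleted, and the other weights rescaled,
without decreasing w(G).  Otherwise every vertex satisfies the (approximate) Lagrange
condition, which by Cauchy-Schwarz forces every degree to be almost C(t,r-1); then |V| is
close to t, the weights are close to uniform, and there are only O(|V|-t) light vertices.
But about (|V|-t) C(t,r-1) edges are missing: those avoiding the light vertices cost too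
much weight, and those meeting them contradict the degree bound.

If |V| = t, let a and b be the two lightest vertices.  Deleting from the complete r-graph
all edges through both a and b allows a and b to be merged, so the rest has weight at most
lam, with a quadratic gain in the deviation of the merged weights from uniform.  It remains
to compare the weight of the C(t-2,r-2) edges through a and b with that of at least as many
missing edges of G.  If the deviation is small compared with w(b), every missing edge not
through a and b outweighs every edge through them; otherwise all but an O(1/t) fraction of
the missing edges contain at most two light vertices and the loss is absorbed by the
quadratic gain. *)

Local Open Scope ring_scope.

(** * Elementary symmetric sums *)

Section WeightedFamilies.
Variables (R : rcfType) (T : finType).
Implicit Types (V W A e : {set T}) (G H : {set {set T}}) (w : T -> R).

Definition ksub V k : {set {set T}} := [set A : {set T} | A \subset V & #|A| == k].

Definition wt w G : R := \sum_(e in G) \prod_(i in e) w i.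

Definition esym w V k : R := wt w (ksub V k).

Lemma mem_ksub V k A : (A \in ksub V k) = (A \subset V) && (#|A| == k).
Proof. by rewrite inE. Qed.

Lemma card_ksub V k : #|ksub V k| = 'C(#|V|, k).
Proof. exact: cards_draws. Qed.

Lemma big_ksub_mem (M : nmodType) (F : {set T} -> M) V i k : i \in V ->
  \sum_(A in ksub V k.+1 | i \in A) F A = \sum_(A in ksub (V :\ i) k) F (i |: A).
Proof.
move=> iV; rewrite (reindex_onto (fun A => i |: A) (fun A => A :\ i)) /=; last first.
  by move=> A /andP[_ iA]; rewrite setD1K.
apply: eq_bigl => A; rewrite !mem_ksub setU11 andbT.
apply/andP/andP => [[/andP[sAV cA] /eqP e]|[sAV cA]].
  have iA : i \notin A by rewrite -e setD11.
  rewrite subsetD1 iA; move: sAV cA; rewrite subUset cardsU1 iA add1n eqSS.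
  by move=> /andP[_ ->] ->.
move: sAV; rewrite subsetD1 => /andP[sAV iA].
rewrite subUset sub1set iV sAV cardsU1 iA add1n eqSS cA /=; split=> //.
by apply/eqP; rewrite setU1K.
Qed.

Lemma big_ksub_notmem (M : nmodType) (F : {set T} -> M) V i k :
  \sum_(A in ksub V k | i \notin A) F A = \sum_(A in ksub (V :\ i) k) F A.
Proof.
apply: eq_bigl => A; rewrite !mem_ksub subsetD1.
by rewrite -!andbA; congr andb; rewrite andbC.
Qed.

Lemma wt_ge0 w G : (forall i, 0 <= w i) -> 0 <= wt w G.
Proof. by move=> w0; apply: sumr_ge0 => e _; apply: prodr_ge0. Qed.

Lemma esym_ge0 w V k : (forall i, 0 <= w i) -> 0 <= esym w V k.
Proof. exact: wt_ge0. Qed.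

Lemma eq_esym w w' V k : {in V, w =1 w'} -> esym w V k = esym w' V k.
Proof.
move=> ww'; apply: eq_bigr => A; rewrite mem_ksub => /andP[/subsetP sAV _].
by apply: eq_bigr => i /sAV /ww'.
Qed.

Lemma wtZ c w G k : {in G, forall e, #|e| = k} ->
  wt (fun i => c * w i) G = c ^+ k * wt w G.
Proof.
move=> cG; rewrite /wt mulr_sumr; apply: eq_bigr => A AG.
by rewrite big_split /= prodr_const (cG _ AG).
Qed.

Lemma esymZ c w V k : esym (fun i => c * w i) V k = c ^+ k * esym w V k.
Proof. by apply: wtZ => A; rewrite mem_ksub => /andP[_ /eqP]. Qed.

Lemma wt_setID w G H : wt w G = wt w (G :&: H) + wt w (G :\: H).
Proof. by rewrite /wt -big_setID. Qed.

Lemma wt_sub w G H : (forall i, 0 <= w i) -> G \subset H -> wt w G <= wt w H.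
Proof.
move=> w0 /setIidPr sGH; rewrite (wt_setID w H G) sGH lerDl; exact: wt_ge0.
Qed.

Lemma esymS w V i k : i \in V ->
  esym w V k.+1 = w i * esym w (V :\ i) k + esym w (V :\ i) k.+1.
Proof.
move=> iV; rewrite /esym /wt (bigID (fun A : {set T} => i \in A)) /=.
rewrite big_ksub_mem // big_ksub_notmem; congr (_ + _).
rewrite mulr_sumr; apply: eq_bigr => A; rewrite mem_ksub subsetD1 => /andP[/andP[_ iA] _].
by rewrite big_setU1.
Qed.

Lemma esym0 w V : esym w V 0 = 1.
Proof.
rewrite /esym /wt (big_pred1 set0) ?big_set0 // => A.
by rewrite mem_ksub cards_eq0 /=; case: eqP => [->|_]; rewrite ?sub0set ?andbF.
Qed.

(** Double counting of the pairs [i \in A]: every set of size [k.+1] arises once from each of its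
    elements. This is Euler's identity for a homogeneous polynomial. *)
Lemma esym_deriv w V k :
  \sum_(i in V) w i * esym w (V :\ i) k = k.+1%:R * esym w V k.+1.
Proof.
transitivity (\sum_(i in V) \sum_(A in ksub V k.+1 | i \in A) \prod_(j in A) w j).
  apply: eq_bigr => i iV; rewrite big_ksub_mem // mulr_sumr; apply: eq_bigr => A.
  by rewrite mem_ksub subsetD1 => /andP[/andP[_ iA] _]; rewrite big_setU1.
rewrite (exchange_big_dep (mem (ksub V k.+1))) /=; last by move=> i A _ /andP[].
rewrite /esym /wt mulr_sumr; apply: eq_bigr => A AV.
move: (AV); rewrite mem_ksub => /andP[/subsetP sAV /eqP cA].
rewrite (eq_bigl (mem A)); last first.
  by move=> i /=; rewrite -mem_ksub AV /=; apply/andP/idP => [[]|iA] //; rewrite sAV.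
by rewrite sumr_const cA mulr_natl.
Qed.

Lemma esym_sum_del w V k :
  \sum_(i in V) esym w (V :\ i) k = (#|V| - k)%:R * esym w V k.
Proof.
transitivity (\sum_(i in V) \sum_(A in ksub V k | i \notin A) \prod_(j in A) w j).
  by apply: eq_bigr => i iV; rewrite big_ksub_notmem.
rewrite (exchange_big_dep (mem (ksub V k))) /=; last by move=> i A _ /andP[].
rewrite /esym /wt mulr_sumr; apply: eq_bigr => A AV.
move: (AV); rewrite mem_ksub => /andP[sAV /eqP cA].
rewrite (eq_bigl (mem (V :\: A))); last first.
  by move=> i /=; rewrite -mem_ksub AV /= inE andbC.
by rewrite sumr_const cardsD (setIidPr sAV) cA mulr_natl.
Qed.

Lemma esym1 w V : esym w V 1 = \sum_(i in V) w i.
Proof.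
rewrite -[LHS]mul1r -(esym_deriv w V 0); apply: eq_bigr => i _.
by rewrite esym0 mulr1.
Qed.

Lemma esym2 w V : 2 * esym w V 2 = (\sum_(i in V) w i) ^+ 2 - \sum_(i in V) w i ^+ 2.
Proof.
rewrite -(esym_deriv w V 1) expr2 mulr_suml -sumrB; apply: eq_bigr => i iV.
by rewrite -(esym1 w V) (esymS w 0 iV) esym0 esym1; ring.
Qed.

(** Summing [(a i - a j) * (b i - b j)] over all ordered pairs gives twice the difference of the two
    sides. *)
Lemma chebyshev_sum V (a b : T -> R) :
  {in V &, forall i j, (a i - a j) * (b i - b j) <= 0} ->
  #|V|%:R * \sum_(i in V) a i * b i <= (\sum_(i in V) a i) * \sum_(i in V) b i.
Proof.
move=> anti.
set X := \sum_(i in V) a i * b i; set Y := (X in _ <= X).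
have dX : \sum_(i in V) \sum_(j in V) a j * b j = #|V|%:R * X.
  by rewrite sumr_const mulr_natl.
have dX' : \sum_(i in V) \sum_(j in V) a i * b i = #|V|%:R * X.
  by rewrite exchange_big /= sumr_const mulr_natl.
have dY : \sum_(i in V) \sum_(j in V) a i * b j = Y.
  by rewrite /Y mulr_suml; apply: eq_bigr => i _; rewrite mulr_sumr.
have dY' : \sum_(i in V) \sum_(j in V) a j * b i = Y.
  by rewrite exchange_big.
suff : #|V|%:R * X + #|V|%:R * X - Y - Y <= 0 by lra.
rewrite -{1}dX -dX' -{1}dY -dY' -big_split -!sumrB /=; apply: sumr_le0 => i iV.
rewrite -big_split -!sumrB /=; apply: sumr_le0 => j jV.
apply: le_trans (anti i j iV jV); rewrite le_eqVlt; apply/orP; left; apply/eqP; ring.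
Qed.

Lemma esym_del_sub w V i j k : i \in V -> j \in V -> i != j ->
  esym w (V :\ i) k.+1 - esym w (V :\ j) k.+1 = (w j - w i) * esym w (V :\ i :\ j) k.
Proof.
move=> iV jV nij.
have jVi : j \in V :\ i by rewrite !inE eq_sym nij.
have iVj : i \in V :\ j by rewrite !inE nij.
rewrite (esymS w k jVi) (esymS w k iVj).
have -> : V :\ j :\ i = V :\ i :\ j by rewrite !setDDl setUC.
ring.
Qed.

(** By [esym_del_sub], deleting a heavier vertex leaves no larger symmetric sum, so [w i] and
    [esym w (V :\ i) k] are oppositely ordered and Chebyshev's inequality applies to the sum in
    [esym_deriv]. *)
Lemma esym_chain w V k : (forall i, 0 <= w i) ->
  (#|V| * k.+1)%:R * esym w V k.+1 <=
  (#|V| - k)%:R * (\sum_(i in V) w i) * esym w V k.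
Proof.
move=> w0; rewrite natrM -mulrA -esym_deriv.
apply: le_trans (chebyshev_sum _) _.
  move=> i j iV jV; have [->|nij] := eqVneq i j; first by rewrite !subrr mul0r.
  case: k => [|k]; first by rewrite !esym0 subrr mulr0.
  rewrite esym_del_sub //.
  have -> : (w i - w j) * ((w j - w i) * esym w (V :\ i :\ j) k) =
            - ((w i - w j) ^+ 2 * esym w (V :\ i :\ j) k) by ring.
  by rewrite oppr_le0 mulr_ge0 ?sqr_ge0 ?esym_ge0.
by rewrite esym_sum_del mulrCA mulrA.
Qed.

(** Maclaurin's inequality, obtained by iterating [esym_chain] from degree 0. *)
Lemma esym_maclaurin w V k : (forall i, 0 <= w i) -> (0 < #|V|)%N ->
  esym w V k <= 'C(#|V|, k)%:R * ((\sum_(i in V) w i) / #|V|%:R) ^+ k.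
Proof.
move=> w0 V0; have n0 : 0 < #|V|%:R :> R by rewrite ltr0n.
set S := \sum_(i in V) w i; have S0 : 0 <= S by apply: sumr_ge0.
elim: k => [|k IHk]; first by rewrite esym0 bin0 mul1r.
have h := esym_chain V k w0.
have hp : 0 < (#|V| * k.+1)%:R :> R by rewrite ltr0n muln_gt0 V0.
rewrite -(ler_pM2l hp); apply: le_trans h _; rewrite -/S.
apply: (@le_trans _ _ ((#|V| - k)%:R * S * ('C(#|V|, k)%:R * (S / #|V|%:R) ^+ k))).
  by apply: ler_wpM2l => //; rewrite mulr_ge0.
rewrite le_eqVlt; apply/orP; left; apply/eqP.
have hb : (k.+1)%:R * 'C(#|V|, k.+1)%:R = (#|V| - k)%:R * 'C(#|V|, k)%:R :> R.
  by rewrite -!natrM mul_bin_left.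
rewrite natrM exprS.
transitivity ((#|V| - k)%:R * 'C(#|V|, k)%:R * S * (S / #|V|%:R) ^+ k); first ring.
by rewrite -hb; field; rewrite gt_eqF.
Qed.

(** The chain of [esym_maclaurin], started in degree 2, where [esym2] expresses the symmetric sum
    exactly through the deviation from uniform weights; the factor gained there survives every later
    step. *)
Lemma esym_stability w V k : (forall i, 0 <= w i) -> (0 < #|V|)%N ->
  \sum_(i in V) w i = #|V|%:R ->
  esym w V k.+2 <= 'C(#|V|, k.+2)%:R * (1 - (\sum_(i in V) (w i - 1) ^+ 2) / #|V|%:R ^+ 2).
Proof.
move=> w0 V0 wS; have n0 : 0 < #|V|%:R :> R by rewrite ltr0n.
set n := #|V| in V0 wS n0 *.
set U := \sum_(i in V) (w i - 1) ^+ 2.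
have U0 : 0 <= U by apply: sumr_ge0 => i _; rewrite sqr_ge0.
elim: k => [|k IHk].
  have e2 := esym2 w V.
  have dU : U = \sum_(i in V) w i ^+ 2 - n%:R.
    rewrite /U (eq_bigr (fun i => w i ^+ 2 - (2 * w i - 1))); last by move=> i _; ring.
    by rewrite sumrB sumrB -mulr_sumr wS sumr_const -/n; ring.
  have hb : 2 * 'C(n, 2)%:R = n%:R ^+ 2 - n%:R :> R.
    by rewrite -natrM mul_bin_left bin1 natrM natrB //; ring.
  rewrite wS in e2.
  rewrite -(ler_pM2l (x := 2)) // e2 mulrA hb.
  have -> : \sum_(i in V) w i ^+ 2 = U + n%:R by rewrite dU; ring.
  have -> : (n%:R ^+ 2 - n%:R) * (1 - U / n%:R ^+ 2) = n%:R ^+ 2 - (U + n%:R) + U / n%:R.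
    by field; rewrite gt_eqF.
  by rewrite lerDl divr_ge0 // ltW.
have h := esym_chain V k.+2 w0.
have hp : 0 < (n * k.+3)%:R :> R by rewrite ltr0n muln_gt0 V0.
rewrite -(ler_pM2l hp); apply: le_trans h _; rewrite wS -/n.
apply: le_trans (ler_wpM2l _ IHk) _; first by rewrite mulr_ge0.
have hb : (k.+3)%:R * 'C(n, k.+3)%:R = (n - k.+2)%:R * 'C(n, k.+2)%:R :> R.
  by rewrite -!natrM mul_bin_left.
set X := 1 - _; rewrite natrM.
have -> : n%:R * k.+3%:R * ('C(n, k.+3)%:R * X) = n%:R * (k.+3%:R * 'C(n, k.+3)%:R) * X.
  by ring.
by rewrite hb le_eqVlt; apply/orP; left; apply/eqP; ring.
Qed.

End WeightedFamilies.

(** * Bernoulli-type inequalities *)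

Lemma bernoulli_ge (R : realFieldType) (x : R) k : 0 <= x <= 1 -> 1 - k%:R * x <= (1 - x) ^+ k.
Proof.
move=> /andP[x0 x1]; elim: k => [|k IH]; first by rewrite mul0r subr0.
rewrite exprS.
apply: (le_trans _ (ler_wpM2l _ IH)); last by rewrite subr_ge0.
rewrite -natr1.
have : 0 <= k%:R * x * x by rewrite !mulr_ge0.
lra.
Qed.

Lemma expr1D_le (R : realFieldType) (x : R) k : 0 <= x <= 1 ->
  (1 + x) ^+ k <= 1 + (2 ^ k)%:R * x.
Proof.
(* The slope is lowered by one, to that of the chord between 0 and 1, so that the induction
   closes. *)
move=> /andP[x0 x1]; suff : (1 + x) ^+ k <= 1 + ((2 ^ k)%:R - 1) * x by lra.
elim: k => [|k IH]; first by rewrite expr0 subrr mul0r addr0.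
rewrite exprS; apply: le_trans (ler_wpM2l _ IH) _; first by lra.
rewrite expnS natrM.
have p1 : 1 <= (2 ^ k)%:R :> R by rewrite ler1n expn_gt0.
set p := (2 ^ k)%:R in p1 *.
have : 0 <= (p - 1) * x * (1 - x) by rewrite !mulr_ge0 //; lra.
lra.
Qed.

(** * Comparing and counting edge families *)

Section Family.
Variables (R : rcfType) (T : finType).
Implicit Types (V W A B e L : {set T}) (G H : {set {set T}}) (w : T -> R).

Lemma prod_ge_bernoulli w A k x : (forall i, 0 <= w i) -> 0 <= x -> (#|A| <= k)%N ->
  {in A, forall i, 1 - x <= w i} -> 1 - k%:R * x <= \prod_(i in A) w i.
Proof.
move=> w0 x0 Ak wx; apply: (@le_trans _ _ (1 - #|A|%:R * x)).
  by rewrite lerD2l lerN2 ler_wpM2r // ler_nat.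
(* For [x > 1] the left side is at most 0 unless [A] is empty, so callers need no upper bound on
   [x]. *)
have [x1|x1] := lerP x 1.
  apply: le_trans (bernoulli_ge _ _) _; first by rewrite x0.
  rewrite -prodr_const; apply: ler_prod => i iA; rewrite subr_ge0 x1; exact: wx.
have [->|] := eqVneq A set0; first by rewrite cards0 big_set0 mul0r subr0.
rewrite -card_gt0 => A0; apply: (@le_trans _ _ 0); last by apply: prodr_ge0.
by rewrite subr_le0; apply: le_trans (ltW x1) _; rewrite ler_peMl // ler1n.
Qed.

Lemma big_ksub_mem2 (M : nmodType) (F : {set T} -> M) V a b k :
  a \in V -> b \in V -> a != b ->
  \sum_(A in ksub V k.+2 | (a \in A) && (b \in A)) F A =
  \sum_(A in ksub (V :\ b :\ a) k) F (b |: (a |: A)).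
Proof.
move=> aV bV nab; have aVb : a \in V :\ b by rewrite !inE nab.
rewrite (eq_bigl (fun A => (A \in ksub V k.+2) && (b \in A) && (a \in A))); last first.
  by move=> A /=; rewrite -andbA [(a \in A) && _]andbC.
rewrite big_mkcondr big_ksub_mem // -big_mkcondr.
rewrite -(@big_ksub_mem _ _ (fun A => F (b |: A)) _ _ k aVb).
by apply: eq_bigl => A; rewrite !inE (negbTE nab).
Qed.

Definition star V a b k : {set {set T}} :=
  [set A in ksub V k | (a \in A) && (b \in A)].

Lemma card_star V a b k : a \in V -> b \in V -> a != b ->
  #|star V a b k.+2| = 'C(#|V| - 2, k).
Proof.
move=> aV bV nab; rewrite cardsE -sum1_card.
have := @big_ksub_mem2 nat (fun=> 1%N) V a b k aV bV nab.
rewrite [X in _ = X -> _]sum1_card card_ksub.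
have -> : #|V :\ b :\ a| = (#|V| - 2)%N.
  have := cardsD1 b V; have := cardsD1 a (V :\ b).
  rewrite bV !inE nab aV /=; lia.
by move=> <-.
Qed.

Lemma wt_star w V a b k : a \in V -> b \in V -> a != b ->
  wt w (star V a b k.+2) = w b * w a * esym w (V :\ b :\ a) k.
Proof.
move=> aV bV nab; rewrite /wt big_set /= big_ksub_mem2 // /esym /wt mulr_sumr.
apply: eq_bigr => A; rewrite mem_ksub !subsetD1 => /andP[/andP[/andP[_ bA] aA] _].
rewrite big_setU1 /=; last by rewrite !inE negb_or eq_sym nab.
by rewrite big_setU1 //= mulrA.
Qed.

(* Removing the star of [ab] leaves a family in which [a] and [b] may be merged into one vertex. *)
Lemma esym_merge w V a b k : a \in V -> b \in V -> a != b ->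
  esym w V k.+2 = wt w (star V a b k.+2) +
    esym (fun i => if i == a then w a + w b else w i) (V :\ b) k.+2.
Proof.
move=> aV bV nab; have aVb : a \in V :\ b by rewrite !inE nab.
rewrite wt_star // (esymS w k.+1 bV) (esymS w k aVb) (esymS w k.+1 aVb).
rewrite [X in _ = _ + X](esymS _ k.+1 aVb) eqxx.
have E j : esym (fun i => if i == a then w a + w b else w i) (V :\ b :\ a) j =
           esym w (V :\ b :\ a) j.
  by apply: eq_esym => i; rewrite !inE => /andP[/negbTE ->].
by rewrite !E; ring.
Qed.

Lemma two_lightest w V : (1 < #|V|)%N -> exists a b,
  [/\ a \in V, b \in V, a != b, w b <= w a & {in V :\ b, forall i, w a <= w i}].
Proof.
move=> V2; have /card_gt0P[x xV] : (0 < #|V|)%N by apply: leq_trans V2.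
pose b := Order.arg_min x (mem V) w.
have [bV bmin] : b \in V /\ forall j, j \in V -> w b <= w j.
  by rewrite /b; case: arg_minP => // i iV h; split.
have /card_gt0P[z zV] : (0 < #|V :\ b|)%N by move: V2; rewrite (cardsD1 b) bV.
pose a := Order.arg_min z (mem (V :\ b)) w.
have [aV amin] : a \in V :\ b /\ forall j, j \in V :\ b -> w a <= w j.
  by rewrite /a; case: arg_minP => // i iV h; split.
move: (aV); rewrite !inE => /andP[nab aV'].
by exists a, b; split => //; apply: bmin.
Qed.

(** Edges common to both families cancel; the rest of [S] is no larger in number than the rest of
    [H], and [c] separates their weights. *)
Lemma wt_le_threshold w (S H : {set {set T}}) c : 0 <= c ->
  {in S, forall e, \prod_(i in e) w i <= c} ->
  {in H :\: S, forall e, c <= \prod_(i in e) w i} ->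
  (#|S| <= #|H|)%N -> wt w S <= wt w H.
Proof.
move=> c0 Sc Hc SH.
rewrite (wt_setID w S H) (wt_setID w H S) setIC lerD2l.
apply: (@le_trans _ _ (c * #|S :\: H|%:R)).
  rewrite /wt mulr_natr -sumr_const; apply: ler_sum => e; rewrite inE => /andP[_]; exact: Sc.
apply: (@le_trans _ _ (c * #|H :\: S|%:R)).
  rewrite ler_wpM2l // ler_nat; have := cardsID H S; have := cardsID S H.
  rewrite setIC; lia.
rewrite /wt mulr_natr -sumr_const; apply: ler_sum => e; exact: Hc.
Qed.

Lemma card_ksub_sup V B r : B \subset V ->
  (#|[set e in ksub V r | B \subset e]| <= 'C(#|V| - #|B|, r - #|B|))%N.
Proof.
move=> BV; rewrite -[X in (_ <= 'C(X - _, _))%N](cardsID B) (setIidPr BV) addKn -card_ksub.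
rewrite -(@card_in_imset _ _ (fun e => e :\: B)); last first.
  move=> e f; rewrite !inE => /andP[_ Be] /andP[_ Bf] ef.
  by rewrite -(setID e B) -(setID f B) ef (setIidPr Be) (setIidPr Bf).
apply/subset_leq_card/subsetP => f /imsetP[e]; rewrite inE mem_ksub => /andP[/andP[eV /eqP ce] Be] ->.
by rewrite mem_ksub setSD //= cardsD (setIidPr Be) ce.
Qed.

(** Union bound over the [j]-subsets of [L] that an edge may contain. *)
Lemma card_ksub_meet V L r j : L \subset V ->
  (#|[set e in ksub V r | j <= #|e :&: L|]%N| <= 'C(#|L|, j) * 'C(#|V| - j, r - j))%N.
Proof.
move=> LV; rewrite -card_ksub.
apply: (@leq_trans #|\bigcup_(B in ksub L j) [set e in ksub V r | B \subset e]|).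
  apply/subset_leq_card/subsetP => e; rewrite inE => /andP[eV].
  have -> : (j <= #|e :&: L|)%N = (0 < #|ksub (e :&: L) j|)%N by rewrite card_ksub bin_gt0.
  case/card_gt0P => B; rewrite mem_ksub subsetI => /andP[/andP[Be BL] cB].
  by apply/bigcupP; exists B; rewrite ?mem_ksub ?BL // inE eV.
apply: (@leq_trans (\sum_(B in ksub L j) #|[set e in ksub V r | B \subset e]|)).
  elim/big_rec2: _ => [|B n F _ Fn]; first by rewrite cards0.
  by apply: leq_trans (leq_card_setU _ _).1 _; rewrite leq_add2l.
rewrite -sum_nat_const; apply: leq_sum => B; rewrite mem_ksub => /andP[BL /eqP <-].
by apply: card_ksub_sup; apply: subset_trans LV.
Qed.

Lemma exists_subset_card (A : {set {set T}}) n : (n <= #|A|)%N ->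
  exists2 B : {set {set T}}, B \subset A & #|B| = n.
Proof.
rewrite -bin_gt0 -cards_draws => /card_gt0P[B]; rewrite inE => /andP[BA /eqP cB].
by exists B.
Qed.

End Family.

(** * Edges through the two lightest vertices *)

Lemma cards_del (T : finType) (A : {set T}) x : x \in A -> #|A :\ x| = #|A|.-1.
Proof. by move=> xA; rewrite (cardsD1 x A) xA. Qed.

(* Counts [a], [b] and the vertices of weight below [1 - c / q], where [q = 16 r^4] and [c^2]
   bounds the sum of the squared deviations. *)
Definition light_cap (k : nat) : nat := (16 * k.+2 ^ 4) ^ 2 + 2.

(* Above this size, each of the two error terms in [wt_star_le_stable] is at most half of the
   available slack [c^2 / (2 r^2)]. *)
Definition stable_bound (k : nat) : nat :=
  16 * k.+2 ^ 3 * (2 ^ k + light_cap k ^ 3 * k * (k.+2 * (1 + 4 * k.+2))).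

Lemma bin_fact_le n m : ('C(n, m) * m`! <= n ^ m)%N.
Proof.
rewrite bin_ffact; elim: m => // m IH; rewrite ffactnSr expnSr.
by apply: leq_mul => //; apply: leq_subr.
Qed.

Lemma mul_bin_del3 n k : (0 < k)%N ->
  ('C(n - 3, k.+2 - 3) * (n - 2) = k * 'C(n - 2, k))%N.
Proof.
case: k => // k _; have -> : (k.+3 - 3 = k)%N by lia.
by rewrite -mul_bin_diag mulnC; have -> : ((n - 2).-1 = n - 3)%N by lia.
Qed.

Section TwoLightest.
Variables (R : rcfType) (T : finType) (V : {set T}) (y : T -> R) (a b : T) (k : nat).
Hypotheses (y_ge0 : forall i, 0 <= y i) (aV : a \in V) (bV : b \in V) (nab : a != b).
Hypotheses (le_ba : y b <= y a) (le_a : {in V :\ b, forall i, y a <= y i}) (a_le1 : y a <= 1).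
Let W := V :\ b :\ a.
Implicit Types (e : {set T}) (H : {set {set T}}).

Let le_b i : i \in V -> y b <= y i.
Proof.
move=> iV; have [->//|nib] := eqVneq i b.
by apply: (le_trans le_ba); apply: le_a; rewrite !inE nib.
Qed.

(** First regime: the deviation [d] is small against [y b]. The threshold is [y b * (1 - y b / 4)]:
    an edge through both vertices stays below it because [y a <= 1 + d - y b], and any other edge
    reaches it, having one vertex of weight at least [y b] and all others in [W], near 1. *)
Lemma wt_star_le_uniform (d : R) H : 0 <= d -> (4 * k.+2)%:R * d <= y b ->
  y a + y b - 1 <= d -> {in W, forall i, `|y i - 1| <= d} ->
  H \subset ksub V k.+2 -> (#|star V a b k.+2| <= #|H|)%N ->
  wt y (star V a b k.+2) <= wt y H.
Proof.
move=> d0 hd ha hW HV cH.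
have s1 : y b <= 1 by apply: le_trans a_le1.
have s0 := y_ge0 b.
have kd : k.+1%:R * d <= y b / 4.
  have : k.+1%:R * d <= k.+2%:R * d by rewrite ler_wpM2r // ler_nat.
  move: hd; rewrite natrM; lra.
have d1 : d <= 1.
  have : d <= k.+1%:R * d by rewrite ler_peMl // ler1n.
  lra.
have Wge i : i \in W -> 1 - d <= y i by move=> /hW; rewrite ler_norml; lra.
have Wle i : i \in W -> y i <= 1 + d by move=> /hW; rewrite ler_norml; lra.
apply: (@wt_le_threshold _ _ _ _ _ (y b * (1 - y b / 4))) => //.
- by apply: mulr_ge0 => //; lra.
- move=> e; rewrite inE mem_ksub => /andP[/andP[eV /eqP ce] /andP[ae be]].
  have aeb : a \in e :\ b by rewrite !inE nab.
  rewrite (big_setD1 b be) (big_setD1 a aeb) /= ler_wpM2l //.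
  have ce' : #|e :\ b :\ a| = k by rewrite !cards_del // ce.
  have P1 : \prod_(i in e :\ b :\ a) y i <= (1 + d) ^+ k.
    rewrite -ce' -prodr_const; apply: ler_prod => i ie; rewrite y_ge0 Wle //.
    by apply: subsetP ie; rewrite !setSD.
  have P2 : 1 - y b / 4 <= (1 - d) ^+ k.
    apply: le_trans (bernoulli_ge _ _); last by rewrite d0.
    have : k%:R * d <= k.+1%:R * d by rewrite ler_wpM2r // ler_nat.
    lra.
  have P3 : (1 - d) ^+ k * (1 + d) ^+ k <= 1.
    have d2 := sqr_ge0 d; have dd : d ^+ 2 <= 1 by apply: exprn_ile1.
    by rewrite -exprMn; apply: exprn_ile1; lra.
  have P4 : 0 <= (1 + d) ^+ k by apply: exprn_ge0; lra.
  have kd1 : d <= y b / 4.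
    by apply: le_trans kd; rewrite ler_peMl // ler1n.
  have P5 : y a <= (1 - y b / 4) ^+ 2 by have := sqr_ge0 (y b); lra.
  (* One factor [1 - y b / 4] remains for the threshold; the other absorbs [(1 + d) ^+ k]. *)
  apply: (@le_trans _ _ ((1 - y b / 4) ^+ 2 * (1 + d) ^+ k)).
    by apply: ler_pM => //; apply: prodr_ge0.
  rewrite expr2 -mulrA ler_piMr; [done|lra|].
  by apply: le_trans P3; apply: ler_wpM2r.
- move=> e; rewrite inE => /andP[eS eH].
  have eVk := subsetP HV _ eH.
  move: (eVk); rewrite mem_ksub => /andP[eV /eqP ce].
  have [x xe exW] : exists2 x, x \in e & e :\ x \subset W.
    case be: (b \in e); [|case ae: (a \in e)].
    - exists b => //; move: eS; rewrite inE eVk be andbT /= => ae.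
      by rewrite subsetD1 setSD // !inE (negbTE ae) andbF.
    - exists a => //; rewrite setSD // subsetD1 eV be //.
    - have /card_gt0P[x xe] : (0 < #|e|)%N by rewrite ce.
      exists x => //; apply: subset_trans (subD1set _ _) _.
      by rewrite !subsetD1 eV be ae.
  rewrite (big_setD1 x xe) /=; apply: ler_pM => //; first by lra.
    by apply: le_b; apply: (subsetP eV).
  apply: le_trans (@prod_ge_bernoulli _ _ _ _ k.+1 d _ _ _ _) => //; first by lra.
    by rewrite cards_del // ce.
  by move=> i /(subsetP exW) /Wge.
Qed.

Lemma prod_ge_pair (B : {set T}) : B \subset V -> (#|B| <= 2)%N ->
  y b * y a <= \prod_(i in B) y i.
Proof.
move=> BV; have ya := y_ge0 a; have yb := y_ge0 b.
case cB: #|B| => [|[|[|//]]] _.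
- move/eqP: cB; rewrite cards_eq0 => /eqP ->; rewrite big_set0 mulr_ile1 //.
  exact: le_trans a_le1.
- move/eqP/cards1P: cB BV => [x ->]; rewrite sub1set big_set1 => xV.
  by apply: (@le_trans _ _ (y b)); rewrite ?le_b // ler_piMr.
- move/eqP/cards2P: cB BV => [x [z [nxz ->]]]; rewrite subUset !sub1set => /andP[xV zV].
  rewrite big_setU1 ?inE //= big_set1.
  have [xb|nxb] := eqVneq x b.
    by rewrite xb; apply: ler_wpM2l => //; apply: le_a; rewrite !inE -xb eq_sym nxz.
  by rewrite mulrC; apply: ler_pM => //; [apply: le_a; rewrite !inE nxb|apply: le_b].
Qed.

(** Crude bound for every edge: one vertex ([b] if present) contributes at least [y b], and the
    others satisfy a weak lower bound. It serves the few edges with three or more light vertices. *)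
Lemma prod_ge_rest e (x : R) : 0 <= x -> e \in ksub V k.+2 ->
  {in V :\ b, forall i, 1 - x <= y i} ->
  y b * y a - y b * (k.+2%:R * x) <= \prod_(i in e) y i.
Proof.
move=> x0; rewrite mem_ksub => /andP[eV /eqP ce] hx.
have [z ze ezV] : exists2 z, z \in e & e :\ z \subset V :\ b.
  case be: (b \in e); first by exists b => //; rewrite setSD.
  have /card_gt0P[z ze] : (0 < #|e|)%N by rewrite ce.
  by exists z => //; apply: subset_trans (subD1set _ _) _; rewrite subsetD1 eV be.
rewrite (big_setD1 z ze) /=.
have P : 1 - k.+2%:R * x <= \prod_(i in e :\ z) y i.
  apply: prod_ge_bernoulli => //; first by rewrite cards_del // ce.
  by move=> i /(subsetP ezV) /hx.
apply: (@le_trans _ _ (y b * \prod_(i in e :\ z) y i)); last first.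
  by apply: ler_wpM2r; [apply: prodr_ge0|apply: le_b; apply: (subsetP eV)].
have s0 := y_ge0 b.
apply: le_trans (ler_wpM2l s0 P).
have : y b * y a <= y b by rewrite ler_piMr.
lra.
Qed.

(** Finer bound for an edge with at most two vertices in [L]: these weigh at least [y b * y a] by
    [prod_ge_pair], so only the error [x] of the vertices outside [L] is lost. *)
Lemma prod_ge_few e (x : R) (L : {set T}) : 0 <= x -> e \in ksub V k.+2 ->
  (#|e :&: L| <= 2)%N -> {in V :\: L, forall i, 1 - x <= y i} ->
  y b * y a - y b * (k.+2%:R * x) <= \prod_(i in e) y i.
Proof.
move=> x0; rewrite mem_ksub => /andP[eV /eqP ce] eL hx.
rewrite (big_setID L) /=.
have P : 1 - k.+2%:R * x <= \prod_(i in e :\: L) y i.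
  apply: prod_ge_bernoulli => //; first by rewrite -ce subset_leq_card // subsetDl.
  by move=> i ie; apply: hx; apply: subsetP ie; rewrite setSD.
have Q : y b * y a <= \prod_(i in e :&: L) y i.
  by apply: prod_ge_pair => //; apply: subset_trans (subsetIl _ _) eV.
have s0 := y_ge0 b; have c0 : 0 <= y b * y a by rewrite mulr_ge0.
apply: (@le_trans _ _ (y b * y a * \prod_(i in e :\: L) y i)); last first.
  by apply: ler_wpM2r => //; apply: prodr_ge0.
apply: le_trans (ler_wpM2l c0 P).
have : y b * y a * (k.+2%:R * x) <= y b * (k.+2%:R * x).
  by apply: ler_wpM2r; [rewrite mulr_ge0|rewrite ler_piMr].
lra.
Qed.

(** Maclaurin on [W], whose mean weight exceeds 1 by at most [|y a + y b - 1| / (|V| - 2)]; the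
    error thus carries a factor of order [1 / |V|]. In that error [y a] is bounded by 1. *)
Lemma wt_star_le_mean : (2 < #|V|)%N -> \sum_(i in V) y i = (#|V|.-1)%:R ->
  wt y (star V a b k.+2) <= 'C(#|V| - 2, k)%:R * (y b * y a) +
    'C(#|V| - 2, k)%:R * y b * ((2 ^ k)%:R * (`|y a + y b - 1| / (#|V| - 2)%:R)).
Proof.
move=> V2 yS; rewrite wt_star // -/W.
have aVb : a \in V :\ b by rewrite !inE nab.
have cW : #|W| = (#|V| - 2)%N by rewrite !cards_del // -subn2.
have W0 : (0 < #|W|)%N by rewrite cW subn_gt0.
have n0 : 0 < #|W|%:R :> R by rewrite ltr0n.
have n1 : 1 <= #|W|%:R :> R by rewrite ler1n.
have SW : \sum_(i in W) y i = #|W|%:R + (1 - (y a + y b)).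
  move: yS; rewrite (big_setD1 b bV) (big_setD1 a aVb) /= -/W.
  have -> : (#|V|.-1)%:R = #|W|%:R + 1 :> R.
    by rewrite cW natr1 subnS prednK ?subn1 // -subn1 subn_gt0 ltnW.
  lra.
rewrite -cW; pose z : R := `|y a + y b - 1|; rewrite -/z.
have zge : 1 - (y a + y b) <= z by rewrite /z; have := ler_norm (- (y a + y b - 1)); rewrite normrN; lra.
have ya := y_ge0 a; have yb := y_ge0 b.
have z1 : z <= 1.
  have : -1 <= y a + y b - 1 by lra.
  have : y a + y b - 1 <= 1 by have := le_ba; have := a_le1; lra.
  by rewrite /z ler_norml => -> ->.
have z0 : 0 <= z by exact: normr_ge0.
have x01 : 0 <= z / #|W|%:R <= 1.
  apply/andP; split; first exact: divr_ge0.
  by rewrite ler_pdivrMr // mul1r; lra.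
have M := esym_maclaurin k y_ge0 W0.
have mean : (\sum_(i in W) y i) / #|W|%:R <= 1 + z / #|W|%:R.
  rewrite SW ler_pdivrMr // mulrDl mul1r divfK ?gt_eqF //; lra.
have mean0 : 0 <= (\sum_(i in W) y i) / #|W|%:R.
  by rewrite divr_ge0 // sumr_ge0.
have M2 : esym y W k <= 'C(#|W|, k)%:R * (1 + (2 ^ k)%:R * (z / #|W|%:R)).
  apply: le_trans M _; apply: ler_wpM2l => //.
  apply: (le_trans _ (expr1D_le _ x01)).
  by apply: lerXn2r => //; rewrite nnegrE //; case/andP: x01; lra.
have c0 : 0 <= y b * y a by rewrite mulr_ge0.
apply: le_trans (ler_wpM2l c0 M2) _.
pose N : R := 'C(#|W|, k)%:R; pose X : R := (2 ^ k)%:R * (z / #|W|%:R); rewrite -/N -/X.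
have X0 : 0 <= N * X by apply: mulr_ge0 => //; apply: mulr_ge0 => //; case/andP: x01.
have : y b * y a * (N * X) <= y b * (N * X) by apply: ler_wpM2r => //; rewrite ler_piMr.
lra.
Qed.

(** Each such vertex contributes at least [(c / q%:R) ^+ 2] to the sum of squares. *)
Lemma card_light (q : nat) (c : R) : 0 < c -> (0 < q)%N ->
  \sum_(i in W) (y i - 1) ^+ 2 <= c ^+ 2 ->
  (#|[set i in W | (y i < 1 - c / q%:R)%R]| <= q ^ 2)%N.
Proof.
move=> c0 q0 hU; set L := [set _ in _ | _].
have q0' : 0 < q%:R :> R by rewrite ltr0n.
have cq0 : 0 < (c / q%:R) ^+ 2 by rewrite exprn_gt0 // divr_gt0.
rewrite -(ler_nat R) -(ler_pM2r cq0) natrX.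
have -> : q%:R ^+ 2 * (c / q%:R) ^+ 2 = c ^+ 2 by field; rewrite gt_eqF.
apply: le_trans hU; rewrite mulr_natl -sumr_const.
apply: (@le_trans _ _ (\sum_(i in L) (y i - 1) ^+ 2)).
  apply: ler_sum => i; rewrite inE => /andP[_ hi].
  rewrite -[(y i - 1) ^+ 2]sqrrN; apply: lerXn2r; rewrite ?nnegrE.
  - by rewrite divr_ge0 // ltW.
  - have : 0 <= c / q%:R by rewrite divr_ge0 // ltW.
    lra.
  - lra.
rewrite [X in _ <= X](big_setID L) /= (setIidPr _) ?lerDl; last first.
  by apply/subsetP => i; rewrite inE => /andP[].
by apply: sumr_ge0 => i _; rewrite sqr_ge0.
Qed.

(** Second regime: [y b] is at most of order [c]. The main term [N * (y b * y a)] of the star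
    cancels against the missing edges; each error carries [y b * c <= 4 r c^2], with [r = k.+2], and
    a small coefficient. *)
Lemma wt_star_le_stable (c : R) H : (0 < k)%N -> (stable_bound k <= #|V| - 2)%N ->
  \sum_(i in V) y i = (#|V|.-1)%:R -> 0 < c -> y b <= (4 * k.+2)%:R * c ->
  `|y a + y b - 1| <= c -> \sum_(i in W) (y i - 1) ^+ 2 <= c ^+ 2 ->
  H \subset ksub V k.+2 -> ('C(#|V| - 2, k) <= #|H|)%N ->
  wt y (star V a b k.+2) - wt y H <= 'C(#|V| - 2, k)%:R * (c ^+ 2 / (2 * k.+2%:R ^+ 2)).
Proof.
move=> k0 hK yS c0 hb ha hU HV cH.
(* Exactly as many missing edges are kept as the star has, so that the main terms cancel. *)
have [H' H'H cH'] := exists_subset_card cH.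
have wtH : wt y H' <= wt y H by apply: wt_sub.
have H'V := subset_trans H'H HV.
pose q := (16 * k.+2 ^ 4)%N.
have q0 : (0 < q)%N by rewrite muln_gt0 expn_gt0.
pose L := [set i in W | y i < 1 - c / q%:R] :|: [set a; b].
have WV : W \subset V by apply: subset_trans (subD1set _ _) (subD1set _ _).
have LV : L \subset V.
  rewrite !subUset !sub1set aV bV !andbT; apply/subsetP => i; rewrite inE => /andP[iW _].
  exact: subsetP iW.
have cL : (#|L| <= light_cap k)%N.
  apply: leq_trans (leq_card_setU _ _).1 _; rewrite cards2 nab leq_add2r.
  exact: card_light.
pose r : R := k.+2%:R; have rE : k.+2%:R = r by [].
have r0 : 0 < r by rewrite ltr0n.
have rn0 : r != 0 by rewrite gt_eqF.
clearbody r.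
have qE : q%:R = 16 * r ^+ 4 :> R by rewrite natrM natrX rE.
have s0 := y_ge0 b.
pose N : R := 'C(#|V| - 2, k)%:R.
pose m : R := (#|V| - 2)%:R.
have V2 : (2 < #|V|)%N.
  rewrite -subn_gt0; apply: leq_trans hK.
  by rewrite /stable_bound !muln_gt0 addn_gt0 !expn_gt0.
have m0 : 0 < m by rewrite ltr0n subn_gt0.
(* Edges with three or more vertices in [L]: as [L] has bounded size, their number is only an
   [O(1 / m)] fraction of [N]. *)
pose B := [set e in ksub V k.+2 | (3 <= #|e :&: L|)%N].
have cB : #|B|%:R * m <= (light_cap k ^ 3)%:R * k%:R * N.
  rewrite -!natrM ler_nat.
  have := card_ksub_meet k.+2 3 LV; rewrite -/B => h.
  apply: (@leq_trans (light_cap k ^ 3 * 'C(#|V| - 3, k.+2 - 3) * (#|V| - 2))).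
    rewrite leq_mul2r; apply/orP; right; apply: leq_trans h _.
    rewrite leq_mul2r; apply/orP; right.
    apply: leq_trans (_ : #|L| ^ 3 <= _)%N; last by rewrite leq_exp2r.
    by apply: leq_trans (bin_fact_le _ _); rewrite leq_pmulr.
  rewrite -!mulnA leq_mul2l; apply/orP; right.
  by rewrite mul_bin_del3.
(* [x1] is the deficit outside [L]. [x2] also covers [a], where
   [y a >= 1 - c - y b >= 1 - (1 + 4 r) c]. *)
pose x1 := c / q%:R; pose x2 := (1 + 4 * r) * c.
have x10 : 0 <= x1 by apply: divr_ge0; rewrite ?ler0n // ltW.
have x20 : 0 <= x2 by apply: mulr_ge0; lra.
have yx x : 0 <= x -> 0 <= y b * (r * x).
  by move=> x0; apply: mulr_ge0 => //; apply: mulr_ge0 => //; apply: ltW.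
have Hlow : N * (y b * y a - y b * (r * x1)) - #|B|%:R * (y b * (r * x2)) <= wt y H'.
  rewrite /N -cH'.
  apply: (@le_trans _ _ (\sum_(e in H') ((y b * y a - y b * (r * x1)) -
            if e \in B then y b * (r * x2) else 0))).
    rewrite sumrB sumr_const -big_mkcondr /= mulr_natl lerD2l lerN2.
    rewrite (eq_bigl (mem (H' :&: B))); last first.
      by move=> e; rewrite -[RHS]/(e \in H' :&: B) in_setI.
    rewrite sumr_const -[X in X <= _]mulr_natl ler_wpM2r ?yx //.
    by rewrite ler_nat subset_leq_card // subsetIr.
  apply: ler_sum => e eH'; have eV := subsetP H'V _ eH'.
  have ybx := yx _ x10.
  case: ifPn => [_|].
    apply: (@le_trans _ _ (y b * y a - y b * (r * x2))); first by lra.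
    rewrite -rE; apply: prod_ge_rest => // i iVb.
    have [->|nia] := eqVneq i a.
      move: ha; rewrite ler_norml => /andP[+ _].
      by move: hb; rewrite natrM rE /x2; lra.
    have iW : i \in W by rewrite /W in_setD1 nia.
    have : (y i - 1) ^+ 2 <= c ^+ 2.
      apply: le_trans hU; rewrite (bigD1 i iW) /= lerDl.
      by apply: sumr_ge0 => j _; rewrite sqr_ge0.
    rewrite -(real_normK (num_real (y i - 1))) ler_pXn2r ?nnegrE //; last exact: ltW.
    rewrite ler_norml => /andP[+ _].
    have : 0 <= r * c by rewrite mulr_ge0 // ltW.
    rewrite /x2; lra.
  rewrite inE eV /= -ltnNge ltnS => eL; rewrite subr0.
  rewrite -rE; apply: (prod_ge_few (L := L)) => // i; rewrite !inE !negb_or.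
  move=> /andP[/andP[h /andP[nia nib]] iV].
  by move: h; rewrite nia nib iV /= -leNgt.
have Sup := wt_star_le_mean V2 yS.
have hE : 16 * r ^+ 3 * ((2 ^ k)%:R + (light_cap k ^ 3)%:R * k%:R * (r * (1 + 4 * r))) <= m.
  have := hK; rewrite -(ler_nat R) /stable_bound !(natrM, natrD) natrX rE; lra.
rewrite -/N -/m in Sup *.
set E := (2 ^ k)%:R + _ in hE.
have N0 : 0 <= N by rewrite ler0n.
have Bm : #|B|%:R <= (light_cap k ^ 3)%:R * k%:R * N / m by rewrite ler_pdivlMr.
have S2 : N * y b * ((2 ^ k)%:R * (`|y a + y b - 1| / m)) <= N * y b * ((2 ^ k)%:R * (c / m)).
  by rewrite !ler_wpM2l ?mulr_ge0 // ler_wpM2r // invr_ge0 ltW.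
have B2 : #|B|%:R * (y b * (r * x2)) <=
          (light_cap k ^ 3)%:R * k%:R * N / m * (y b * (r * x2)).
  by rewrite ler_wpM2r // yx.
have D : wt y (star V a b k.+2) - wt y H <= N * (y b * c) * (E / m + r / q%:R).
  have -> : N * (y b * c) * (E / m + r / q%:R) = N * y b * ((2 ^ k)%:R * (c / m)) +
     (light_cap k ^ 3)%:R * k%:R * N / m * (y b * (r * x2)) + N * (y b * (r * x1)).
    by rewrite /E /x1 /x2; ring.
  lra.
apply: (le_trans D).
have E0 : 0 <= E.
  apply: addr_ge0 => //; apply: mulr_ge0; first exact: mulr_ge0.
  by apply: mulr_ge0; [exact: ltW|lra].
have E1 : E / m <= 1 / (16 * r ^+ 3).
  rewrite ler_pdivrMr // mulrAC ler_pdivlMr ?mulr_gt0 ?exprn_gt0 //; lra.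
have E2 : r / q%:R = 1 / (16 * r ^+ 3) by rewrite qE; field; rewrite rn0.
(* [y b <= 4 r c], and both [E / m] and [r / q] are at most [1 / (16 r^3)], which gives the factor
   [1 / (2 r^2)]. *)
apply: (@le_trans _ _ (N * ((4 * r) * c * c) * (2 / (16 * r ^+ 3)))).
  apply: ler_pM.
  - by rewrite !mulr_ge0 // ltW.
  - exact: addr_ge0 (divr_ge0 E0 (ltW m0)) (divr_ge0 (ltW r0) (ler0n _ _)).
  - by apply: ler_wpM2l => //; apply: ler_wpM2r; [exact: ltW|rewrite -rE -natrM].
  - rewrite E2; lra.
by rewrite le_eqVlt rE; apply/orP; left; apply/eqP; field; rewrite rn0.
Qed.

End TwoLightest.

(** Lets the quadratic gain of [esym_stability] pay for the loss in [wt_star_le_stable]. It holds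
    because [n - 2 - k] is at least half of [n.-1]. *)
Lemma bin_slack n k : (2 * k.+2 <= n)%N ->
  (n.-1 ^ 2 * 'C(n - 2, k) <= 2 * k.+2 ^ 2 * 'C(n.-1, k.+2))%N.
Proof.
move=> hn.
have h1 : (k.+2 * 'C(n.-1, k.+2) = n.-1 * 'C(n - 2, k.+1))%N.
  by rewrite -mul_bin_diag; have -> : (n.-1.-1 = n - 2)%N by lia.
have h2 := mul_bin_left (n - 2) k.
have -> : (2 * k.+2 ^ 2 * 'C(n.-1, k.+2) = 2 * k.+2 * (n.-1 * 'C(n - 2, k.+1)))%N.
  by rewrite -h1; lia.
have h3 : (k.+1 * 'C(n - 2, k.+1) <= k.+2 * 'C(n - 2, k.+1))%N by rewrite leq_mul2r leqnSn orbT.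
have -> : (2 * k.+2 * (n.-1 * 'C(n - 2, k.+1)) = n.-1 * (2 * (k.+2 * 'C(n - 2, k.+1))))%N by lia.
rewrite expnS expn1 -mulnA leq_mul2l; apply/orP; right.
apply: (@leq_trans (2 * (n - 2 - k) * 'C(n - 2, k))); last by lia.
by rewrite leq_mul2r; apply/orP; right; lia.
Qed.

(** * Exactly t vertices *)

Section AtMostT.
Variables (R : rcfType) (T : finType).

Lemma ler_norm_sqrt_sum (A : {set T}) (f : T -> R) i : i \in A ->
  `|f i| <= Num.sqrt (\sum_(j in A) f j ^+ 2).
Proof.
move=> iA; rewrite -sqrtr_sqr; apply: ler_wsqrtr.
by rewrite (bigD1 i iA) /= lerDl sumr_ge0 // => j _; rewrite sqr_ge0.
Qed.

(** The weights have total [|V| - 1], so that after merging [a] and [b] their mean is 1; the bound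
    is then the number of edges of the complete graph on the merged vertices. *)
Lemma esym_sub_wt_le (V : {set T}) (y : T -> R) k (H : {set {set T}}) :
  (0 < k)%N -> (stable_bound k <= #|V| - 2)%N -> (2 * k.+2 <= #|V|)%N ->
  (forall i, 0 <= y i) -> \sum_(i in V) y i = (#|V|.-1)%:R ->
  H \subset ksub V k.+2 -> ('C(#|V| - 2, k) <= #|H|)%N ->
  esym y V k.+2 - wt y H <= 'C(#|V|.-1, k.+2)%:R.
Proof.
move=> k0 hK hV y0 yS HV cH.
have V1 : (1 < #|V|)%N by apply: leq_trans hV.
have [a [b [aV bV nab leba lea]]] := two_lightest y V1.
have aVb : a \in V :\ b by rewrite !inE nab.
pose n := #|V|.-1.
have cVb : #|V :\ b| = n by rewrite cards_del.
have n0 : (0 < n)%N by rewrite /n -subn1 subn_gt0.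
have n0' : 0 < n%:R :> R by rewrite ltr0n.
have a1 : y a <= 1.
  rewrite -(ler_pM2l n0') mulr1 mulr_natl -cVb -sumr_const.
  apply: (@le_trans _ _ (\sum_(i in V :\ b) y i)); first exact: ler_sum.
  by rewrite cVb /n -yS (big_setD1 b bV) /= lerDr.
pose y' i := if i == a then y a + y b else y i.
have y'0 i : 0 <= y' i by rewrite /y'; case: eqP => // _; rewrite addr_ge0.
have y'W i : i \in V :\ b :\ a -> y' i = y i.
  by rewrite /y' in_setD1 => /andP[/negbTE ->].
have y'S : \sum_(i in V :\ b) y' i = #|V :\ b|%:R.
  rewrite cVb -yS (big_setD1 b bV) !(big_setD1 a aVb) /= (eq_bigr _ y'W) /y' eqxx.
  by rewrite addrCA addrA.
pose U := \sum_(i in V :\ b) (y' i - 1) ^+ 2.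
have UE : U = (y a + y b - 1) ^+ 2 + \sum_(i in V :\ b :\ a) (y i - 1) ^+ 2.
  rewrite /U (big_setD1 a aVb) /= {1}/y' eqxx; congr (_ + _).
  by apply: eq_bigr => i /y'W ->.
have U0 : 0 <= U by apply: sumr_ge0 => i _; rewrite sqr_ge0.
pose c : R := Num.sqrt U.
have c0 : 0 <= c by apply: sqrtr_ge0.
have cU : c ^+ 2 = U by rewrite sqr_sqrtr.
have ca : `|y a + y b - 1| <= c.
  by have := ler_norm_sqrt_sum (fun i => y' i - 1) aVb; rewrite {1}/y' eqxx.
have cW i : i \in V :\ b :\ a -> `|y i - 1| <= c.
  move=> iW; have iVb : i \in V :\ b by apply: (subsetP (subD1set _ a)).
  by have := ler_norm_sqrt_sum (fun i => y' i - 1) iVb; rewrite {1}y'W.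
pose N : R := 'C(#|V| - 2, k)%:R.
have star_le : wt y (star V a b k.+2) - wt y H <= N * (c ^+ 2 / (2 * k.+2%:R ^+ 2)).
  have r0 : 0 < (4 * k.+2)%:R :> R by rewrite ltr0n.
  (* The two regimes: the deviation [c] of the merged weights is small or large against [y b]. *)
  have [cd|dc] := lerP c (y b / (4 * k.+2)%:R).
    apply: (@le_trans _ _ 0); last first.
      by apply: mulr_ge0 => //; apply: divr_ge0; rewrite ?sqr_ge0 // mulr_ge0 // exprn_ge0.
    rewrite subr_le0; apply: (wt_star_le_uniform y0 nab leba lea a1 (d := y b / (4 * k.+2)%:R)) => //.
    - by rewrite divr_ge0 // ltW.
    - by rewrite mulrC divfK // gt_eqF.
    - by apply: le_trans (ler_norm _) (le_trans ca cd).
    - by move=> i /cW h; apply: le_trans h cd.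
    - by rewrite card_star.
  have cp : 0 < c by apply: le_lt_trans dc; rewrite divr_ge0 // ltW.
  apply: wt_star_le_stable => //.
    by move: (ltW dc); rewrite ler_pdivrMr // mulrC.
  by rewrite cU UE lerDr sqr_ge0.
have stab : esym y' (V :\ b) k.+2 <= 'C(n, k.+2)%:R * (1 - U / n%:R ^+ 2).
  by have := @esym_stability _ _ y' (V :\ b) k; rewrite y'S cVb; apply.
rewrite (esym_merge y k aV bV nab).
have slack : N * (c ^+ 2 / (2 * k.+2%:R ^+ 2)) <= 'C(n, k.+2)%:R * (U / n%:R ^+ 2).
  rewrite cU !mulrA ler_pdivrMr; last by rewrite !mulr_gt0 ?ltr0n.
  rewrite mulrAC ler_pdivlMr ?exprn_gt0 //.
  have := bin_slack hV; rewrite -(ler_nat R) !natrM ?natrX -/n -/N => h.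
  have := ler_wpM2r U0 h; lra.
rewrite -/y' -/n; have := le_trans star_le slack; move: stab; rewrite mulrBr mulr1; lra.
Qed.

End AtMostT.

(** * Power sums and falling products *)

Section FallingProduct.
Variable R : realFieldType.
Implicit Types (g h x : R) (j n r : nat).

(** For [h = 1 / n] this is the falling factorial of [n] divided by [n ^ j], that is [j!] times the
    weight of the complete [j]-graph under uniform weights on [n] vertices. A real [h] allows
    different [n] to be compared. *)
Definition fallp h j : R := \prod_(i < j) (1 - i%:R * h).

Lemma fallpS h j : fallp h j.+1 = fallp h j * (1 - j%:R * h).
Proof. by rewrite /fallp big_ord_recr. Qed.

Lemma fallp_itv h j : 0 <= h -> j%:R * h <= 1 -> 0 <= fallp h j <= 1.
Proof.
move=> h0 jh; apply/andP; split.
  apply: prodr_ge0 => i _; rewrite subr_ge0; apply: le_trans jh.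
  by rewrite ler_wpM2r // ler_nat ltnW.
apply: Num.Theory.prodr_ile1 => i _; rewrite subr_ge0 lerBlDr lerDl mulr_ge0 // andbT.
by apply: le_trans jh; rewrite ler_wpM2r // ler_nat ltnW.
Qed.

Lemma fallp_ge h j : 0 <= h -> j%:R * h <= 1 -> 1 - j%:R ^+ 2 * h <= fallp h j.
Proof.
move=> h0; elim: j => [|j IH] jh; first by rewrite /fallp big_ord0; nra.
have jh' : j%:R * h <= 1 by apply: le_trans jh; rewrite ler_wpM2r // ler_nat.
have /andP[f0 f1] := fallp_itv h0 jh'.
rewrite fallpS; have := IH jh'; set F := fallp _ _ in f0 f1 *.
have jh0 : 0 <= j%:R * h by rewrite mulr_ge0.
have : F * (j%:R * h) <= j%:R * h by rewrite ler_piMl.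
rewrite -[j.+1]addn1 natrD; lra.
Qed.

Lemma fallp_sub_le g h j : 0 <= g -> g <= h -> j%:R * h <= 1 ->
  fallp g j - fallp h j <= j%:R ^+ 2 * (h - g).
Proof.
move=> g0 gh; have h0 := le_trans g0 gh.
elim: j => [|j IH] jh; first by rewrite /fallp !big_ord0 subrr expr0n mul0r.
have jh' : j%:R * h <= 1 by apply: le_trans jh; rewrite ler_wpM2r // ler_nat.
have jg : j%:R * g <= j%:R * h by rewrite ler_wpM2l.
have jg' : j%:R * g <= 1 by apply: le_trans jh'.
have /andP[f0 f1] := fallp_itv h0 jh'.
rewrite !fallpS; have := IH jh'; set F := fallp h j in f0 f1 *; set E := fallp g j.
move=> IHj.
have jg0 : 0 <= j%:R * g by rewrite mulr_ge0.
have P1 : (E - F) * (1 - j%:R * g) <= j%:R ^+ 2 * (h - g).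
  apply: (@le_trans _ _ (j%:R ^+ 2 * (h - g) * (1 - j%:R * g))).
    by apply: ler_wpM2r => //; lra.
  apply: ler_piMr; last by lra.
  by apply: mulr_ge0; [exact: sqr_ge0|lra].
have P2 : F * (j%:R * h - j%:R * g) <= j%:R * h - j%:R * g by apply: ler_piMl => //; lra.
have : 0 <= j%:R * (h - g) by apply: mulr_ge0 => //; lra.
rewrite -[j.+1]addn1 natrD; lra.
Qed.

Lemma bin_fallp n j : (0 < n)%N -> (j <= n)%N ->
  (j`!)%:R * 'C(n, j)%:R = n%:R ^+ j * fallp (n%:R^-1) j.
Proof.
move=> n0; have n0' : n%:R != 0 :> R by rewrite pnatr_eq0 -lt0n.
rewrite -natrM mulnC bin_ffact; elim: j => [|j IH] jn.
  by rewrite /fallp big_ord0 mulr1.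
rewrite ffactnSr natrM IH ?(ltnW jn) // natrB ?(ltnW jn) // fallpS exprSr.
by field.
Qed.

Lemma expr1B_le x j : 0 <= x <= 1 -> (1 - x) ^+ j <= 1 - j%:R * x + j%:R ^+ 2 * x ^+ 2.
Proof.
move=> /andP[x0 x1]; elim: j => [|j IH]; first by rewrite expr0; lra.
rewrite exprSr; apply: le_trans (ler_wpM2r _ IH) _; first by lra.
rewrite -[j.+1]addn1 natrD.
have : 0 <= j%:R * x ^+ 2 by rewrite mulr_ge0 // sqr_ge0.
have : 0 <= j%:R ^+ 2 * x ^+ 3 by rewrite mulr_ge0 ?sqr_ge0 ?exprn_ge0.
have := sqr_ge0 x; lra.
Qed.

End FallingProduct.

Lemma cube_step k : (k.+2 ^ 3 + k.+2 * k.+1 <= k.+3 ^ 3)%N.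
Proof. by rewrite !expnS expn0 !muln1; nia. Qed.

(** * Symmetric sums and moments of a weighting *)

Section EsymBounds.
Variables (R : rcfType) (T : finType).
Implicit Types (V : {set T}) (w : T -> R).

Lemma esym_del_le w V i k : (forall i, 0 <= w i) -> esym w (V :\ i) k <= esym w V k.
Proof.
move=> w0; apply: wt_sub => //; apply/subsetP => A; rewrite !mem_ksub subsetD1 -andbA.
by case/and3P => -> _ ->.
Qed.

Lemma esymS_le w V k : (forall i, 0 <= w i) ->
  k.+1%:R * esym w V k.+1 <= (\sum_(i in V) w i) * esym w V k.
Proof.
move=> w0; rewrite -esym_deriv mulr_suml; apply: ler_sum => i _.
by apply: ler_wpM2l => //; apply: esym_del_le.
Qed.

Lemma fact_esym_le w V k : (forall i, 0 <= w i) ->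
  (k`!)%:R * esym w V k <= (\sum_(i in V) w i) ^+ k.
Proof.
move=> w0; elim: k => [|k IH]; first by rewrite esym0 mul1r.
rewrite factS mulnC natrM -mulrA exprS.
apply: le_trans (ler_wpM2l _ (esymS_le V k w0)) _ => //.
by rewrite mulrCA ler_wpM2l // sumr_ge0.
Qed.

End EsymBounds.

Section Moments.
Variables (R : rcfType) (T : finType) (V : {set T}) (w : T -> R).
Hypotheses (w_ge0 : forall i, 0 <= w i) (w_sum1 : \sum_(i in V) w i = 1).

Let p2 := \sum_(i in V) w i ^+ 2.
Let p3 := \sum_(i in V) w i ^+ 3.

Let esymS_le1 k : k.+1%:R * esym w V k.+1 <= esym w V k.
Proof. by have := esymS_le V k w_ge0; rewrite w_sum1 mul1r. Qed.

Let fact_esym_le1 k : (k`!)%:R * esym w V k <= 1.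
Proof. by have := fact_esym_le V k w_ge0; rewrite w_sum1 expr1n. Qed.

Lemma fact_esym_le2 k : ((k.+2)`!)%:R * esym w V k.+2 <= 1 - p2.
Proof.
elim: k => [|k IH].
  by have := esym2 w V; rewrite w_sum1 expr1n -/p2 /= => <-.
by apply: le_trans IH; rewrite (factS k.+2) mulnC natrM -mulrA ler_wpM2l.
Qed.

(** Newton's identity cut after the third power sum: [esymS] is applied twice to remove [i], and the
    remaining sum over [V :\ i] is bounded by the one over [V]. *)
Lemma esym_newton k :
  k.+3%:R * esym w V k.+3 <= esym w V k.+2 - p2 * esym w V k.+1 + p3 * esym w V k.
Proof.
rewrite -esym_deriv -[X in X - _]mul1r -w_sum1 /p2 /p3 !mulr_suml -sumrB -big_split /=.
apply: ler_sum => i iV.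
have e2 := esymS w k.+1 iV; have e1 := esymS w k iV.
have h := esym_del_le V i k w_ge0.
have -> : w i * esym w (V :\ i) k.+2 =
  w i * esym w V k.+2 - w i ^+ 2 * esym w V k.+1 + w i ^+ 3 * esym w (V :\ i) k.
  by rewrite e2 e1; ring.
by rewrite lerD2l ler_wpM2l // exprn_ge0.
Qed.

(** Induction by [esym_newton]. Since [h <= p2], raising the degree from [k.+2] multiplies by at
    most [1 - k.+2%:R * h], the next factor of [fallp], up to an error in [p3]. Keeping [1 - p2]
    from degree 2 retains the first-order dependence on [p2]. *)
Lemma fact_esym_fallp h k : 0 <= h -> k.+2%:R * h <= 1 -> h <= p2 ->
  (1 - h) * (((k.+2)`!)%:R * esym w V k.+2) <= (1 - p2) * fallp h k.+2 + k.+2%:R ^+ 3 * p3.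
Proof.
move=> h0; have p30 : 0 <= p3 by apply: sumr_ge0 => i _; rewrite exprn_ge0.
elim: k => [|k IH] kh hp.
  have e2 : (2`!)%:R * esym w V 2 = 1 - p2.
    by have := esym2 w V; rewrite w_sum1 expr1n -/p2.
  rewrite e2 /fallp !big_ord_recr big_ord0 /= mul1r mul0r subr0 mul1r mul1r mulrC lerDl.
  by rewrite mulr_ge0 // exprn_ge0.
have kh' : k.+2%:R * h <= 1 by apply: le_trans kh; rewrite ler_wpM2r // ler_nat.
have := IH kh' hp => {}IH.
have N := esym_newton k.
have S1 := esymS_le1 k.+1.
have S0 := fact_esym_le1 k.
set e3 := esym w V k.+3 in N *; set e2 := esym w V k.+2 in IH N S1 *.
set e1 := esym w V k.+1 in N S1; set e0 := esym w V k in N S0.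
have e20 : 0 <= e2 by apply: esym_ge0.
have p20 : 0 <= p2 by apply: le_trans hp.
have h1 : h <= 1 by apply: le_trans kh; rewrite ler_peMl // ler1n.
rewrite (factS k.+2) natrM fallpS.
set f : R := (k.+2)`!%:R in IH *.
have f0 : 0 <= f by rewrite ler0n.
have fE : f = k.+2%:R * k.+1%:R * (k`!)%:R by rewrite /f !factS !natrM mulrA.
have A1 : h * (k.+2%:R * e2) <= p2 * e1.
  apply: ler_pM => //; exact: mulr_ge0.
have A2 : f * (k.+3%:R * e3) <= f * e2 * (1 - k.+2%:R * h) + f * (p3 * e0).
  apply: le_trans (ler_wpM2l f0 N) _.
  have := ler_wpM2l f0 A1; lra.
have A3 : f * (p3 * e0) <= k.+2%:R * k.+1%:R * p3.
  rewrite fE.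
  have -> : k.+2%:R * k.+1%:R * k`!%:R * (p3 * e0) = k.+2%:R * k.+1%:R * p3 * (k`!%:R * e0) by ring.
  by apply: ler_piMr => //; rewrite !mulr_ge0.
have q0 : 0 <= 1 - k.+2%:R * h by lra.
have A4 : (1 - h) * (f * e2) * (1 - k.+2%:R * h) <=
   (1 - p2) * (fallp h k.+2 * (1 - k.+2%:R * h)) + k.+2%:R ^+ 3 * p3.
  apply: le_trans (ler_wpM2r q0 IH) _.
  rewrite mulrDl mulrA lerD2l; apply: ler_piMr.
    by rewrite mulr_ge0 // exprn_ge0.
  have : 0 <= k.+2%:R * h by rewrite mulr_ge0.
  lra.
have A5 : (1 - h) * (k.+2%:R * k.+1%:R * p3) <= k.+2%:R * k.+1%:R * p3.
  by apply: ler_piMl; [rewrite !mulr_ge0|lra].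
have A6 : (1 - h) * (f * (k.+3%:R * e3)) <=
   (1 - h) * (f * e2 * (1 - k.+2%:R * h) + k.+2%:R * k.+1%:R * p3).
  apply: ler_wpM2l; lra.
have A7 : k.+2%:R ^+ 3 * p3 + k.+2%:R * k.+1%:R * p3 <= k.+3%:R ^+ 3 * p3.
  by rewrite -mulrDl ler_wpM2r // -!natrX -natrM -natrD ler_nat cube_step.
have -> : (1 - h) * (k.+3%:R * f * e3) = (1 - h) * (f * (k.+3%:R * e3)) by ring.
lra.
Qed.

(** Only the loss in degree 2 is used: [1 - r^2 h <= fallp h r <= 1 - p2] with [r = k.+2]. *)
Lemma p2_le k h : 0 <= h -> k.+2%:R * h <= 1 ->
  fallp h k.+2 <= ((k.+2)`!)%:R * esym w V k.+2 -> p2 <= k.+2%:R ^+ 2 * h.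
Proof.
by move=> h0 kh hf; have := fact_esym_le2 k; have := fallp_ge h0 kh; lra.
Qed.

(** Once the weights are at most [c], [p3 <= c * p2], and [fact_esym_fallp] leaves [(p2 - h) * fallp
    h k.+2 <= k.+2%:R ^+ 3 * c * p2], where the falling product is at least one half. *)
Lemma p2_sharp k h (c : R) : 0 <= h -> k.+2%:R ^+ 2 * h <= 2^-1 -> k.+2%:R * h <= 1 ->
  0 <= c -> {in V, forall i, w i <= c} ->
  fallp h k.+2 <= ((k.+2)`!)%:R * esym w V k.+2 ->
  p2 * (1 - 2 * k.+2%:R ^+ 3 * c) <= h.
Proof.
move=> h0 k2h kh c0 wc hf.
have p20 : 0 <= p2 by apply: sumr_ge0 => i _; rewrite sqr_ge0.
have k30 : 0 <= k.+2%:R ^+ 3 :> R by rewrite exprn_ge0.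
have [hp|/ltW ph] := lerP h p2; last first.
  have : 0 <= k.+2%:R ^+ 3 * c * p2 by rewrite !mulr_ge0.
  lra.
have p3c : p3 <= c * p2.
  rewrite /p3 /p2 mulr_sumr; apply: ler_sum => i iV.
  by rewrite exprS ler_wpM2r ?sqr_ge0 ?wc.
have F := fact_esym_fallp h0 kh hp.
have h1 : h <= 1 by apply: le_trans kh; rewrite ler_peMl // ler1n.
have f2 : 2^-1 <= fallp h k.+2 by have := fallp_ge h0 kh; lra.
have A1 : (1 - h) * fallp h k.+2 <= (1 - p2) * fallp h k.+2 + k.+2%:R ^+ 3 * p3.
  by apply: le_trans F; apply: ler_wpM2l => //; lra.
have A2 : k.+2%:R ^+ 3 * p3 <= k.+2%:R ^+ 3 * (c * p2) by apply: ler_wpM2l.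
have A3 : (p2 - h) * 2^-1 <= (p2 - h) * fallp h k.+2 by apply: ler_wpM2l => //; lra.
lra.
Qed.

End Moments.

(** * Degrees *)

(** Each of the [n - t] Pascal steps adds at least ['C(t, k)]. *)
Lemma bin_increment t n k : (t <= n)%N -> ('C(t, k.+1) + (n - t) * 'C(t, k) <= 'C(n, k.+1))%N.
Proof.
move=> /subnK <-; move: (n - t)%N => d; rewrite addnK; elim: d => [|d IH].
  by rewrite mul0n addn0.
rewrite addSn binS mulSn addnCA addnC; apply: leq_add => //.
by apply: leq_bin2l; apply: leq_addl.
Qed.

Section Degrees.
Variables (R : rcfType) (T : finType).
Implicit Types (V : {set T}) (G H : {set {set T}}) (w : T -> R) (i : T).

Definition through G i : {set {set T}} := [set e in G | i \in e].
Definition avoid G i : {set {set T}} := [set e in G | i \notin e].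

(** The partial derivative of the weight of [G] in the coordinate [i]. *)
Definition link_wt w G i : R := \sum_(e in through G i) \prod_(j in e :\ i) w j.

Lemma wt_link w G i : wt w G = w i * link_wt w G i + wt w (avoid G i).
Proof.
rewrite /wt (bigID (fun e : {set T} => i \in e)) /=; congr (_ + _); last first.
  by apply: eq_bigl => e; rewrite !inE.
rewrite /link_wt big_set /= mulr_sumr; apply: eq_bigr => e /andP[_ ie].
by rewrite (big_setD1 i ie).
Qed.

Lemma sum_degree V G k : G \subset ksub V k -> (\sum_(i in V) #|through G i| = k * #|G|)%N.
Proof.
move=> GV.
transitivity (\sum_(i in V) \sum_(e in G | i \in e) 1)%N.
  by apply: eq_bigr => i _; rewrite -sum1_card; apply: eq_bigl => e; rewrite inE.
rewrite (exchange_big_dep (mem G)) /=; last by move=> i e _ /andP[].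
rewrite mulnC -sum_nat_const; apply: eq_bigr => e eG.
move: (subsetP GV _ eG); rewrite mem_ksub => /andP[/subsetP eV /eqP <-].
rewrite -sum1_card; apply: eq_bigl => i; rewrite eG /=.
by apply/andP/idP => [[]|ie] //; rewrite eV.
Qed.

Lemma card_through_ksub V k i : i \in V -> #|through (ksub V k.+1) i| = 'C(#|V|.-1, k).
Proof.
move=> iV; rewrite -sum1_card.
have := @big_ksub_mem T nat (fun=> 1%N) V i k iV.
rewrite [X in _ = X -> _]sum1_card card_ksub cards_del // => <-.
by rewrite big_set.
Qed.

Lemma cauchy_schwarz_card (I : finType) (A : {set I}) (f : I -> R) :
  (\sum_(x in A) f x) ^+ 2 <= #|A|%:R * \sum_(x in A) f x ^+ 2.
Proof.
have := @chebyshev_sum R I A f (fun x => - f x).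
have -> : \sum_(x in A) f x * - f x = - \sum_(x in A) f x ^+ 2.
  by rewrite -sumrN; apply: eq_bigr => x _; ring.
rewrite sumrN !mulrN lerN2 -expr2; apply => x z _ _.
have := sqr_ge0 (f x - f z); lra.
Qed.

(** Cauchy-Schwarz over the edges through [i]; the sum of the squared link products is at most the
    symmetric sum of the squared weights, hence at most the [k]-th power of the second moment over
    [k!]. *)
Lemma link_wt_sqr_le w V G k i : (forall i, 0 <= w i) -> i \in V -> G \subset ksub V k.+1 ->
  ((k`!)%:R * link_wt w G i) ^+ 2 <=
  (k`!)%:R * #|through G i|%:R * (\sum_(j in V) w j ^+ 2) ^+ k.
Proof.
move=> w0 iV GV.
have CS := cauchy_schwarz_card (through G i) (fun e => \prod_(j in e :\ i) w j).
have w20 j : 0 <= w j ^+ 2 by rewrite sqr_ge0.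
have P : \sum_(e in through G i) (\prod_(j in e :\ i) w j) ^+ 2 <=
         esym (fun j => w j ^+ 2) V k.
  apply: le_trans (esym_del_le V i k w20).
  rewrite /esym /wt.
  have -> : \sum_(e in ksub (V :\ i) k) \prod_(j in e) w j ^+ 2 =
            \sum_(e in ksub (V :\ i) k) \prod_(j in (i |: e) :\ i) w j ^+ 2.
    apply: eq_bigr => e; rewrite mem_ksub subsetD1 => /andP[/andP[_ ie] _].
    by rewrite setU1K.
  rewrite -(@big_ksub_mem _ _ (fun e => \prod_(j in e :\ i) w j ^+ 2) V i k iV).
  under eq_bigr => e _ do rewrite -prodrXl.
  rewrite [X in _ <= X](bigID (mem G)) /=.
  rewrite (eq_bigl (fun e => (e \in ksub V k.+1) && (i \in e) && (e \in G))).
    rewrite lerDl; apply: sumr_ge0 => e _; exact: prodr_ge0.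
  move=> e /=; rewrite /through inE andbC andbAC.
  by case eG: (e \in G); rewrite ?andbF //= (subsetP GV) ?andbT.
have F := fact_esym_le V k w20.
rewrite exprMn expr2 -!mulrA ler_wpM2l // mulrA.
apply: (@le_trans _ _ ((k`!)%:R * (#|through G i|%:R * esym (fun j => w j ^+ 2) V k))).
  by rewrite -mulrA ler_wpM2l //; apply: le_trans CS _; rewrite ler_wpM2l.
by rewrite mulrCA ler_wpM2l.
Qed.

(* The last hypothesis bounds the weight of the link of [i] from below to first order;
   Cauchy-Schwarz turns this into a bound on the degree. *)
Lemma degree_ge w V G k i (h c : R) : (forall i, 0 <= w i) -> i \in V -> G \subset ksub V k.+2 ->
  0 < h -> 0 <= c -> 4 * k.+2%:R ^+ 4 * c <= 1 -> k.+2%:R ^+ 2 * h <= c -> w i <= c ->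
  (\sum_(j in V) w j ^+ 2) * (1 - 2 * k.+2%:R ^+ 3 * c) <= h ->
  fallp h k.+2 <= ((k.+2)`!)%:R * wt w G ->
  wt w (avoid G i) < (1 - w i) ^+ k.+2 * wt w G ->
  1 - 4 * k.+2%:R ^+ 4 * c <= ((k.+1)`!)%:R * #|through G i|%:R * h ^+ k.+1.
Proof.
move=> w0 iV GV h0 c0 c1 hc wc p2h hf hdel.
pose r : R := k.+2%:R; have rE : k.+2%:R = r by [].
have r2 : 2 <= r by rewrite ler_nat.
clearbody r; rewrite rE in c1 hc p2h *.
have r3 : 4 <= r ^+ 3.
  have : 2 ^+ 3 <= r ^+ 3 by apply: lerXn2r; rewrite ?nnegrE //; lra.
  lra.
have r21 : 1 <= r ^+ 2 by apply: exprn_ege1; lra.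
have rc0 : 0 <= r * c by apply: mulr_ge0 => //; lra.
have r4c : 4 * (r * c) <= r ^+ 4 * c.
  have := ler_wpM2r rc0 r3; lra.
have c_le1 : c <= 1.
  have : 2 * c <= r * c by rewrite ler_wpM2r.
  lra.
have rh : k.+2%:R * h <= 1.
  rewrite rE; have : 0 <= r * (r - 1) * h by apply: mulr_ge0; [apply: mulr_ge0; lra|exact: ltW].
  lra.
have fh := fallp_ge (ltW h0) rh; rewrite rE in fh.
set g := wt w G in hf hdel.
have g0 : 0 <= g by apply: wt_ge0.
have lk := wt_link w G i; rewrite -/g in lk.
set s := w i in wc lk hdel; have s0 : 0 <= s by apply: w0.
set P := link_wt w G i in lk.
have s1 : 0 <= s <= 1 by rewrite s0 (le_trans wc).
have up := ler_wpM2r g0 (expr1B_le k.+2 s1); rewrite rE in up.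
(* Deletion of [i] fails, so the edges avoiding [i] weigh less than [(1 - s)^r g]; expanding the
   power to second order bounds the link from below. *)
have sP : s * (g * (r - r ^+ 2 * s)) < s * P by lra.
have sgt0 : 0 < s.
  by rewrite lt_neqAle s0 andbT; apply: contraTneq sP => <-; rewrite !mul0r ltxx.
have Pge : g * (r - r ^+ 2 * s) < P by move: sP; rewrite ltr_pM2l.
have f0 : 0 <= ((k.+1)`!)%:R :> R by rewrite ler0n.
have grc : 0 <= g * r ^+ 2 * (c - s).
  by rewrite !mulr_ge0 ?exprn_ge0 //; lra.
have P2 : g * (r * (1 - r * c)) <= P by lra.
have P3 : ((k.+2)`!)%:R * g * (1 - r * c) <= ((k.+1)`!)%:R * P.
  rewrite factS natrM rE.
  have -> : r * ((k.+1)`!)%:R * g * (1 - r * c) = ((k.+1)`!)%:R * (g * (r * (1 - r * c))) by ring.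
  by rewrite ler_wpM2l.
have rc1 : 0 <= 1 - r * c by lra.
(* [r! g >= fallp h r >= 1 - r^2 h >= 1 - c]. *)
have P4 : 1 - 2 * (r * c) <= ((k.+1)`!)%:R * P.
  apply: le_trans P3; apply: (@le_trans _ _ ((1 - c) * (1 - r * c))).
    have : 0 <= c * (r * c) by apply: mulr_ge0.
    have : 0 <= (r - 1) * c by apply: mulr_ge0 => //; lra.
    lra.
  by apply: ler_wpM2r => //; lra.
have L := link_wt_sqr_le w0 iV GV; rewrite -/P in L.
set p2 := \sum_(j in V) w j ^+ 2 in p2h L.
have p20 : 0 <= p2 by apply: sumr_ge0 => j _; rewrite sqr_ge0.
set fP := _ * P in P4 L.
have sq : 1 - 4 * (r * c) <= fP ^+ 2.
  apply: (@le_trans _ _ ((1 - 2 * (r * c)) ^+ 2)).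
    have := sqr_ge0 (r * c); lra.
  by apply: lerXn2r; rewrite ?nnegrE //; lra.
have r3c : 0 <= r ^+ 3 * c by apply: mulr_ge0 => //; lra.
have r3c1 : 2 * (r ^+ 3 * c) <= 1.
  have : 2 * (r ^+ 3 * c) <= r * (r ^+ 3 * c) by rewrite ler_wpM2r.
  lra.
have be : 1 - k.+1%:R * (2 * (r ^+ 3 * c)) <= (1 - 2 * (r ^+ 3 * c)) ^+ k.+1.
  by apply: bernoulli_ge; lra.
have be2 : 1 - 2 * (r ^+ 4 * c) <= (1 - 2 * (r ^+ 3 * c)) ^+ k.+1.
  apply: le_trans be; rewrite -(natr1 k.+1) in rE.
  have -> : k.+1%:R = r - 1 by rewrite -rE; ring.
  lra.
have b1 : 0 <= (1 - 2 * (r ^+ 3 * c)) ^+ k.+1 by apply: exprn_ge0; lra.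
have ph : p2 ^+ k.+1 * (1 - 2 * (r ^+ 3 * c)) ^+ k.+1 <= h ^+ k.+1.
  rewrite -exprMn; apply: lerXn2r; rewrite ?nnegrE; [|exact: ltW|lra].
  apply: mulr_ge0 => //; lra.
apply: (@le_trans _ _ (fP ^+ 2 * (1 - 2 * (r ^+ 3 * c)) ^+ k.+1)).
  apply: (@le_trans _ _ ((1 - 4 * (r * c)) * (1 - 2 * (r ^+ 4 * c)))).
    have : 0 <= r * c * (r ^+ 4 * c) by apply: mulr_ge0 => //; lra.
    lra.
  apply: ler_pM => //; lra.
apply: le_trans (ler_wpM2r b1 L) _.
by rewrite -[X in X <= _]mulrA ler_wpM2l // mulr_ge0.
Qed.

End Degrees.

(** * Missing edges and light vertices *)

Section Missing.
Variables (R : rcfType) (T : finType).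
Implicit Types (V : {set T}) (G H : {set {set T}}) (w : T -> R) (i : T).

(** With [r = k.+2] and [n = |V|], [esym_stability] bounds the complete sum by [fallp (1/n) r] minus
    a multiple of the deviation, while [G] already attains [fallp h r]. The gap, at most
    [r^2 (h - 1/n)] by [fallp_sub_le], bounds both the missing weight and the deviation. *)
Lemma missing_weight_le w V G k (h : R) : (forall i, 0 <= w i) -> \sum_(i in V) w i = 1 ->
  G \subset ksub V k.+2 -> (0 < #|V|)%N -> #|V|%:R^-1 <= h -> k.+2%:R * h <= 1 ->
  k.+2%:R ^+ 2 * h <= 2^-1 -> fallp h k.+2 <= ((k.+2)`!)%:R * wt w G ->
  wt w (ksub V k.+2 :\: G) <= k.+2%:R ^+ 2 * (h - #|V|%:R^-1) /\
  \sum_(i in V) (#|V|%:R * w i - 1) ^+ 2 <=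
    2 * #|V|%:R ^+ 2 * (k.+2%:R ^+ 2 * (h - #|V|%:R^-1)).
Proof.
move=> w0 wS GV V0 nh rh r2h hf.
set n := #|V| in V0 nh *.
have n0 : 0 < n%:R :> R by rewrite ltr0n.
have nn0 : n%:R != 0 :> R by rewrite gt_eqF.
have ni0 : 0 <= n%:R^-1 :> R by rewrite invr_ge0 ltW.
have rni : k.+2%:R * n%:R^-1 <= 1 :> R by apply: le_trans rh; rewrite ler_wpM2l.
have rn : (k.+2 <= n)%N by move: rni; rewrite ler_pdivrMr // mul1r ler_nat.
pose U := \sum_(i in V) (n%:R * w i - 1) ^+ 2.
have U0 : 0 <= U by apply: sumr_ge0 => i _; rewrite sqr_ge0.
have y0 i : 0 <= n%:R * w i by rewrite mulr_ge0.
have yS : \sum_(i in V) n%:R * w i = #|V|%:R by rewrite -mulr_sumr wS mulr1.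
have st := esym_stability k y0 V0 yS; rewrite esymZ -/n -/U in st.
have f0 : 0 <= ((k.+2)`!)%:R :> R by rewrite ler0n.
have f1 : 1 <= ((k.+2)`!)%:R :> R by rewrite ler1n fact_gt0.
have nr0 : 0 < n%:R ^+ k.+2 :> R by rewrite exprn_gt0.
pose F : R := fallp n%:R^-1 k.+2.
have es : ((k.+2)`!)%:R * esym w V k.+2 <= F * (1 - U / n%:R ^+ 2).
  have := ler_wpM2l f0 st.
  by rewrite [X in _ <= X]mulrA (bin_fallp R V0 rn) mulrCA -[X in _ <= X]mulrA ler_pM2l.
have F2 : 2^-1 <= F.
  have := fallp_ge ni0 rni.
  have : k.+2%:R ^+ 2 * n%:R^-1 <= k.+2%:R ^+ 2 * h by rewrite ler_wpM2l // sqr_ge0.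
  rewrite -/F; lra.
have Fs := fallp_sub_le ni0 nh rh; rewrite -/F in Fs.
have wE : esym w V k.+2 = wt w G + wt w (ksub V k.+2 :\: G).
  by rewrite /esym (wt_setID w _ G) (setIidPr GV).
set H := ksub V k.+2 :\: G in wE *.
have H0 : 0 <= wt w H by apply: wt_ge0.
have Un0 : 0 <= U / n%:R ^+ 2 by rewrite divr_ge0 // exprn_ge0 // ltW.
set X := _ * (h - _) in Fs *.
have FU : 2^-1 * (U / n%:R ^+ 2) <= F * (U / n%:R ^+ 2) by rewrite ler_wpM2r.
have key : ((k.+2)`!)%:R * wt w H + 2^-1 * (U / n%:R ^+ 2) <= X.
  rewrite wE in es; lra.
have fH : wt w H <= ((k.+2)`!)%:R * wt w H by rewrite ler_peMl.
split; first by lra.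
have : U / n%:R ^+ 2 <= 2 * X by lra.
rewrite ler_pdivrMr ?exprn_gt0 // -/U; lra.
Qed.

Lemma card_lt_half (V : {set T}) (y : T -> R) :
  #|[set i in V | y i < 2^-1]|%:R <= 4 * \sum_(i in V) (y i - 1) ^+ 2.
Proof.
set L := [set _ in _ | _].
apply: (@le_trans _ _ (4 * \sum_(i in L) (y i - 1) ^+ 2)).
  rewrite mulr_sumr -[#|L|%:R]mulr_natl mulr1 -sumr_const; apply: ler_sum => i.
  rewrite inE => /andP[_ yi].
  have : (2^-1) ^+ 2 <= (1 - y i) ^+ 2 by apply: lerXn2r; rewrite ?nnegrE //; lra.
  lra.
rewrite ler_wpM2l // [X in _ <= X](big_setID L) /= (setIidPr _) ?lerDl.
  by apply: sumr_ge0 => i _; rewrite sqr_ge0.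
by apply/subsetP => i; rewrite inE => /andP[].
Qed.

Lemma card_avoiding_le w V H (L : {set T}) r (c : R) : (forall i, 0 <= w i) -> 0 <= c ->
  H \subset ksub V r -> {in V :\: L, forall i, c <= w i} ->
  #|[set e in H | [disjoint e & L]]|%:R * c ^+ r <= wt w H.
Proof.
move=> w0 c0 HV wc; set H0 := [set _ in _ | _].
have H0H : H0 \subset H by apply/subsetP => e; rewrite inE => /andP[].
apply: le_trans (wt_sub w0 H0H); rewrite mulr_natl -sumr_const; apply: ler_sum => e.
rewrite inE => /andP[eH dis].
move: (subsetP HV _ eH); rewrite mem_ksub => /andP[eV /eqP <-].
rewrite -prodr_const; apply: ler_prod => i ie; rewrite c0 wc // inE (subsetP eV) // andbT.
by rewrite (disjointFr dis ie).
Qed.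

Lemma card_split_hit H (L : {set T}) :
  (#|H| <= #|[set e in H | [disjoint e & L]]| + \sum_(i in L) #|through H i|)%N.
Proof.
rewrite -(cardsID [set e : {set T} | [disjoint e & L]] H).
have -> : H :&: [set e : {set T} | [disjoint e & L]] = [set e in H | [disjoint e & L]].
  by apply/setP => e; rewrite !inE.
rewrite leq_add2l.
apply: (@leq_trans #|\bigcup_(i in L) through H i|).
  apply/subset_leq_card/subsetP => e; rewrite !inE => /andP[nd eH].
  have /pred0Pn[i /andP[ie iL]] : ~~ [disjoint e & L] by [].
  by apply/bigcupP; exists i => //; rewrite inE eH.
elim/big_rec2: _ => [|i F n _ Fn]; first by rewrite cards0.
by apply: leq_trans (leq_card_setU _ _).1 _; rewrite leq_add2l.
Qed.

End Missing.

(** * More than t vertices of high degree *)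

Section Descent.
Variables (R : rcfType) (T : finType).
Implicit Types (V : {set T}) (G H : {set {set T}}) (w : T -> R) (i : T).

(** The degrees sum to [k.+2 * #|G|], and [(k.+2)! * #|G| <= t ^ k.+2]. *)
Lemma card_le_of_degree V G k t (c : R) : (0 < t)%N ->
  G \subset ksub V k.+2 -> (#|G| <= 'C(t, k.+2))%N ->
  {in V, forall i, c * t%:R ^+ k.+1 <= ((k.+1)`!)%:R * #|through G i|%:R} ->
  #|V|%:R * c <= t%:R.
Proof.
move=> t0 GV cG hd.
have tp : 0 < t%:R ^+ k.+1 :> R by rewrite exprn_gt0 // ltr0n.
rewrite -(ler_pM2r tp) -exprS -mulrA.
apply: (@le_trans _ _ (\sum_(i in V) ((k.+1)`!)%:R * #|through G i|%:R)).
  by rewrite mulr_natl -sumr_const; apply: ler_sum.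
rewrite -mulr_sumr -natr_sum (sum_degree GV) -natrM -natrX ler_nat.
apply: leq_trans (bin_fact_le t k.+2).
by rewrite factS mulnA [in X in (_ <= X)%N]mulnC [((k.+1)`! * _)%N]mulnC leq_mul2l cG orbT.
Qed.

(** As [V] is barely larger than [t], the degree of [i] in the complete family is at most about
    [t ^ k.+1 / (k.+1)!], and [G] already has nearly as many edges at [i]. *)
Lemma through_missing_le V G k t i (d : R) : i \in V -> G \subset ksub V k.+2 ->
  0 <= d -> 4 * d <= 1 -> #|V|%:R <= t%:R * (1 + 4 * d) ->
  (1 - 2 * d) * t%:R ^+ k.+1 <= ((k.+1)`!)%:R * #|through G i|%:R ->
  ((k.+1)`!)%:R * #|through (ksub V k.+2 :\: G) i|%:R <= t%:R ^+ k.+1 * ((2 ^ (k + 4))%:R * d).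
Proof.
move=> iV GV d0 d1 nt hd.
have cE : (#|through (ksub V k.+2 :\: G) i| + #|through G i| = 'C(#|V|.-1, k.+1))%N.
  rewrite -(card_through_ksub k.+1 iV) -(cardsID G (through (ksub V k.+2) i)) addnC.
  congr (_ + _)%N; apply: eq_card => e; rewrite !inE; last by rewrite -andbA.
  case eG: (e \in G); rewrite ?andbF // andbT.
  by move: (subsetP GV _ eG); rewrite inE => ->.
have tp : 0 <= t%:R ^+ k.+1 :> R by rewrite exprn_ge0.
have up : ((k.+1)`!)%:R * 'C(#|V|.-1, k.+1)%:R <= t%:R ^+ k.+1 * (1 + (2 ^ k.+1)%:R * (4 * d)) :> R.
  apply: (@le_trans _ _ (#|V|%:R ^+ k.+1)).
    rewrite -natrM -natrX ler_nat mulnC; apply: leq_trans (bin_fact_le _ _) _.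
    by rewrite leq_exp2r // leq_pred.
  apply: (@le_trans _ _ ((t%:R * (1 + 4 * d)) ^+ k.+1)).
    by apply: lerXn2r; rewrite ?nnegrE //; apply: le_trans nt.
  rewrite exprMn ler_wpM2l //; apply: expr1D_le; lra.
rewrite -cE natrD mulrDr in up.
have p1 : 1 <= (2 ^ k)%:R :> R by rewrite ler1n expn_gt0.
have -> : (2 ^ (k + 4))%:R = 16 * (2 ^ k)%:R :> R by rewrite expnD natrM mulrC.
rewrite expnS natrM in up.
have : 0 <= t%:R ^+ k.+1 * d * ((2 ^ k)%:R - 1) by rewrite !mulr_ge0 // subr_ge0.
have : 0 <= t%:R ^+ k.+1 * d by rewrite mulr_ge0.
lra.
Qed.

(** Passing from powers of [t.-1] to powers of [t] costs a factor [(1 - 1/t) ^ k.+1 >= 1 - d],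
    whence the second [d]. *)
Lemma degree_scale k t (d h x : R) : (1 < t)%N -> h = (t.-1)%:R^-1 -> 0 <= d <= 1 ->
  k.+2%:R * h <= d -> 1 - d <= x * h ^+ k.+1 -> (1 - 2 * d) * t%:R ^+ k.+1 <= x.
Proof.
move=> t1 hE /andP[d0 d1] rh hx.
have t0 : (0 < t)%N by apply: ltnW.
have u0 : 0 < (t.-1)%:R :> R by rewrite ltr0n -subn1 subn_gt0.
have tE : t%:R = (t.-1)%:R + 1 :> R by rewrite natr1 prednK.
have t0' : 0 < t%:R :> R by rewrite ltr0n.
have h0 : 0 < h by rewrite hE invr_gt0.
have th : t%:R^-1 <= h by rewrite hE lef_pV2 ?posrE // tE; lra.
have kt : k.+1%:R * t%:R^-1 <= d.
  apply: le_trans rh; apply: ler_pM => //; first by rewrite invr_ge0 ltW.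
  by rewrite ler_nat.
have ti1 : t%:R^-1 <= 1 :> R by rewrite invf_le1 // ler1n.
have B : 1 - d <= (1 - t%:R^-1) ^+ k.+1.
  apply: le_trans (bernoulli_ge k.+1 _); first by lra.
  by rewrite invr_ge0 ltW.
have hx2 : (1 - d) * (t.-1)%:R ^+ k.+1 <= x.
  by move: hx; rewrite hE exprVn ler_pdivlMr // exprn_gt0.
apply: le_trans hx2.
have uE : (t.-1)%:R = t%:R * (1 - t%:R^-1) :> R.
  by rewrite mulrBr mulr1 divff ?gt_eqF // tE; ring.
rewrite uE exprMn mulrCA [X in X <= _]mulrC.
apply: ler_wpM2l; first by rewrite exprn_ge0 // ltW.
apply: (@le_trans _ _ ((1 - d) * (1 - d))); first by have := sqr_ge0 d; lra.
by apply: ler_wpM2l => //; lra.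
Qed.

(* The many missing edges force either a heavy missing family or a light vertex of large
   missing degree; both are excluded. *)
Lemma high_degree_absurd w V G k t (d h : R) :
  (forall i, 0 <= w i) -> \sum_(i in V) w i = 1 ->
  G \subset ksub V k.+2 -> (#|G| <= 'C(t, k.+2))%N -> (1 < t)%N -> (t < #|V|)%N ->
  h = (t.-1)%:R^-1 -> 0 < d -> (2 ^ (k + 12))%:R * k.+2%:R ^+ 2 * d <= 1 ->
  k.+2%:R * h <= d -> ((k.+1)`!)%:R * (2 ^ (2 * k + 7))%:R * k.+2%:R ^+ 2 * h <= 1 ->
  fallp h k.+2 <= ((k.+2)`!)%:R * wt w G ->
  {in V, forall i, 1 - d <= ((k.+1)`!)%:R * #|through G i|%:R * h ^+ k.+1} -> False.
Proof.
move=> w0 wS GV cG t1 tn hE d0 hd rh hh hf deg.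
have t0 : (0 < t)%N by apply: ltnW.
have V0 : (0 < #|V|)%N by apply: leq_ltn_trans tn.
pose r : R := k.+2%:R; have rE : k.+2%:R = r by [].
have r2 : 2 <= r by rewrite ler_nat.
clearbody r; rewrite rE in hd rh hh.
have r24 : 4 <= r ^+ 2.
  have : 2 ^+ 2 <= r ^+ 2 by apply: lerXn2r; rewrite ?nnegrE //; lra.
  lra.
pose q : R := (2 ^ k)%:R; have qE : (2 ^ k)%:R = q by [].
have q1 : 1 <= q by rewrite ler1n expn_gt0.
clearbody q.
have e12 : (2 ^ (k + 12))%:R = 16 * 16 * 16 * q :> R.
  by rewrite expnD natrM mulrC qE -!natrM.
have e7 : (2 ^ (2 * k + 7))%:R = 16 * 8 * q ^+ 2 :> R.
  by rewrite expnD [(2 * k)%N]mulnC expnM natrM natrX qE mulrC -!natrM.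
rewrite e12 in hd; rewrite e7 in hh.
have r2d : 16 * (r ^+ 2 * d) <= 1.
  apply: le_trans hd.
  have rd0 : 0 <= r ^+ 2 * d by apply: mulr_ge0; [exact: sqr_ge0|exact: ltW].
  have : 0 <= (q - 1) * (r ^+ 2 * d) by apply: mulr_ge0 => //; lra.
  lra.
have d16 : 16 * d <= 1.
  have : 0 <= (r ^+ 2 - 4) * d by apply: mulr_ge0; lra.
  lra.
have u0 : 0 < (t.-1)%:R :> R by rewrite ltr0n -subn1 subn_gt0.
have h0 : 0 < h by rewrite hE invr_gt0.
have uh : (t.-1)%:R * h = 1 by rewrite hE divff // gt_eqF.
pose ta : R := t%:R; pose nu : R := #|V|%:R.
have taE : ta = (t.-1)%:R + 1 by rewrite /ta natr1 prednK.
have ta0 : 0 < ta by rewrite ltr0n.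
have nu0 : 0 < nu by rewrite ltr0n.
pose D := nu - ta.
have D1 : 1 <= D by rewrite /D /nu /ta lerBrDr addrC natr1 ler_nat.
have D0 : 0 <= D := le_trans ler01 D1.
have q0 : 0 <= q := le_trans ler01 q1.
pose P := ta ^+ k.+1.
have P0 : 0 < P by rewrite exprn_gt0.
have fk0 : 0 <= ((k.+1)`!)%:R :> R by rewrite ler0n.
have deg2 i : i \in V -> (1 - 2 * d) * P <= ((k.+1)`!)%:R * #|through G i|%:R.
  move=> iV; apply: (@degree_scale k t d h) => //; first by lra.
    by rewrite rE.
  exact: deg.
have nt : nu * (1 - 2 * d) <= ta by apply: (card_le_of_degree t0 GV cG).
have nt2 : nu <= ta * (1 + 4 * d).
  have A : nu * (1 - 2 * d) * (1 + 4 * d) <= ta * (1 + 4 * d).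
    by apply: ler_wpM2r => //; lra.
  have : 0 <= nu * (2 * d * (1 - 4 * d)) by apply: mulr_ge0; [exact: ltW|apply: mulr_ge0; lra].
  lra.
have nt3 : nu <= 2 * ta.
  have : 0 <= ta * (1 - 4 * d) by apply: mulr_ge0; [exact: ltW|lra].
  lra.
have hd1 : h <= d.
  have : 0 <= (r - 1) * h by apply: mulr_ge0; [lra|exact: ltW].
  lra.
have nuh : nu * h <= 2.
  have A : nu * h <= ta * (1 + 4 * d) * h by apply: ler_wpM2r => //; exact: ltW.
  have B : ta * h = 1 + h by rewrite taE mulrDl uh mul1r.
  have C : ta * (1 + 4 * d) * h = (1 + h) * (1 + 4 * d) by rewrite mulrAC B.
  have : h * d <= d * 1 by rewrite mulrC ler_pM2l //; lra.
  lra.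
have nuV : nu^-1 <= h.
  rewrite hE lef_pV2 ?posrE //; move: D1; rewrite /D taE; lra.
have rh1 : k.+2%:R * h <= 1 by rewrite rE; lra.
have r2h : k.+2%:R ^+ 2 * h <= 2^-1.
  rewrite rE; have : r ^+ 2 * h <= r ^+ 2 * d by apply: ler_wpM2l => //; exact: sqr_ge0.
  lra.
have [wH Ule] := missing_weight_le w0 wS GV V0 nuV rh1 r2h hf.
set H := ksub V k.+2 :\: G in wH; rewrite -/nu rE in wH Ule.
(* [nu * h - 1 = D * h + h], and the extra [h] is absorbed since [D >= 1]. *)
have hX : nu * (r ^+ 2 * (h - nu^-1)) <= 2 * (r ^+ 2 * (h * D)).
  have -> : nu * (r ^+ 2 * (h - nu^-1)) = r ^+ 2 * (nu * h - 1).
    by rewrite mulrCA mulrBr divff ?gt_eqF.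
  have -> : nu * h = D * h + 1 + h.
    have : ta * h = 1 + h by rewrite taE mulrDl uh mul1r.
    by rewrite /D; lra.
  rewrite mulrCA; apply: ler_wpM2l; first exact: sqr_ge0.
  have : h <= D * h by apply: ler_peMl => //; exact: ltW.
  lra.
pose y i := nu * w i.
have U8 : \sum_(i in V) (y i - 1) ^+ 2 <= 8 * (r ^+ 2 * D).
  apply: (le_trans Ule).
  have -> : 2 * nu ^+ 2 * (r ^+ 2 * (h - nu^-1)) = 2 * nu * (nu * (r ^+ 2 * (h - nu^-1))) by ring.
  apply: (@le_trans _ _ (2 * nu * (2 * (r ^+ 2 * (h * D))))).
    by apply: ler_wpM2l => //; rewrite mulr_ge0 // ltW.
  have : nu * h * (r ^+ 2 * D) <= 2 * (r ^+ 2 * D).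
    by apply: ler_wpM2r => //; apply: mulr_ge0 => //; exact: sqr_ge0.
  lra.
(* Vertices of less than half the average weight; the deviation bound leaves only [O(D)] of them. *)
pose L := [set i in V | y i < 2^-1].
have cL : #|L|%:R <= 32 * (r ^+ 2 * D).
  by apply: le_trans (card_lt_half _ _) _; lra.
have HV : H \subset ksub V k.+2 by apply: subsetDl.
have wc : {in V :\: L, forall i, (2 * nu)^-1 <= w i}.
  move=> i; rewrite !inE => /andP[+ iV]; rewrite iV /= -leNgt /y => h2.
  rewrite -(ler_pM2l nu0); apply: le_trans h2.
  by rewrite invfM mulrCA divff ?gt_eqF // mulr1.
have c0 : 0 <= (2 * nu)^-1 by rewrite invr_ge0 mulr_ge0 // ltW.
have H0le := card_avoiding_le w0 c0 HV wc.
set H0 := [set e in H | _] in H0le.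
(* Each missing edge avoiding [L] weighs at least [(2 nu)^-r], so the small missing weight allows
   few of them. *)
have H0b : #|H0|%:R <= 8 * q * nu ^+ k.+1 * (2 * (r ^+ 2 * (h * D))) * 2^-1.
  have A : #|H0|%:R * (2 * nu)^-1 ^+ k.+2 <= r ^+ 2 * (h - nu^-1) by apply: le_trans wH.
  rewrite exprVn ler_pdivrMr in A; last by rewrite exprn_gt0 // mulr_gt0.
  apply: (le_trans A); rewrite exprMn.
  have -> : 2 ^+ k.+2 = 4 * q :> R by rewrite -natrX expnS expnS !natrM qE; ring.
  have -> : r ^+ 2 * (h - nu^-1) * (4 * q * nu ^+ k.+2) =
            4 * q * nu ^+ k.+1 * (nu * (r ^+ 2 * (h - nu^-1))) by rewrite [nu ^+ k.+2]exprS; ring.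
  have : 4 * q * nu ^+ k.+1 * (nu * (r ^+ 2 * (h - nu^-1))) <=
         4 * q * nu ^+ k.+1 * (2 * (r ^+ 2 * (h * D))).
    by apply: ler_wpM2l => //; rewrite !mulr_ge0 // exprn_ge0 // ltW.
  lra.
have H1b i : i \in L ->
   ((k.+1)`!)%:R * #|through H i|%:R <= P * (16 * q * d).
  rewrite inE => /andP[iV _].
  have := @through_missing_le V G k t i d iV GV (ltW d0) _ nt2 (deg2 i iV).
  by rewrite expnD natrM qE [q * _]mulrC; apply; lra.
have split := card_split_hit H L; rewrite -/H0 in split.
have hbin := bin_increment k.+1 (ltnW tn).
have cH : (#|G| + #|H| = 'C(#|V|, k.+2))%N.
  by rewrite -card_ksub -(cardsID G (ksub V k.+2)) (setIidPr GV).
(* At least [D * 'C(t, k.+1)] edges are missing, as [G] has at most ['C(t, k.+2)]. *)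
have binl : D * 'C(t, k.+1)%:R <= #|H|%:R.
  rewrite /D /nu /ta -natrB ?(ltnW tn) // -natrM ler_nat.
  rewrite -(leq_add2l #|G|) cH; apply: leq_trans hbin; by rewrite leq_add2r.
have tV0 : 0 <= ta^-1 by rewrite invr_ge0 ltW.
have tVh : ta^-1 <= h by rewrite hE lef_pV2 ?posrE // taE lerDl.
have k1r : k.+1%:R <= r by rewrite -rE ler_nat.
have kt1 : k.+1%:R * ta^-1 <= 1.
  by apply: le_trans rh1; rewrite rE; apply: ler_pM.
have tk : (k.+1 <= t)%N.
  by move: kt1; rewrite ler_pdivrMr // mul1r ler_nat.
have binP : P * 2^-1 <= ((k.+1)`!)%:R * 'C(t, k.+1)%:R.
  rewrite (bin_fallp R t0 tk) -/ta; apply: ler_wpM2l; first exact: ltW.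
  apply: le_trans (fallp_ge tV0 kt1).
  have : k.+1%:R ^+ 2 * ta^-1 <= r ^+ 2 * h.
    apply: ler_pM => //; first exact: sqr_ge0.
    by apply: lerXn2r; rewrite ?nnegrE // (le_trans _ r2).
  by move: r2h; rewrite rE; clear; lra.
have low : D * P * 2^-1 <= ((k.+1)`!)%:R * #|H|%:R.
  apply: (@le_trans _ _ (((k.+1)`!)%:R * (D * 'C(t, k.+1)%:R))); last by apply: ler_wpM2l.
  by rewrite mulrCA -mulrA; apply: ler_wpM2l.
have nuP : nu ^+ k.+1 <= 2 * q * P.
  apply: (@le_trans _ _ ((2 * ta) ^+ k.+1)); first by apply: lerXn2r; rewrite ?nnegrE ?mulr_ge0 // ltW.
  by rewrite exprMn -natrX expnS natrM qE /P.
have DP0 : 0 < D * P by apply: mulr_gt0 => //; apply: lt_le_trans D1.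
(* The missing edges off [L], and then those meeting [L], are each shown to number at most a quarter
   of the lower bound in [low]. *)
have up0 : ((k.+1)`!)%:R * #|H0|%:R <= D * P * 8^-1.
  apply: le_trans (ler_wpM2l fk0 H0b) _.
  apply: (@le_trans _ _ (((k.+1)`!)%:R * (8 * q * (2 * q * P) * (2 * (r ^+ 2 * (h * D))) * 2^-1))).
    have q80 : 0 <= 8 * q by rewrite mulr_ge0.
    have X0 : 0 <= 2 * (r ^+ 2 * (h * D)).
      apply: mulr_ge0 => //; apply: mulr_ge0; first exact: sqr_ge0.
      by apply: mulr_ge0 => //; exact: ltW.
    apply: ler_wpM2l => //; apply: ler_wpM2r; first by rewrite invr_ge0.
    by apply: ler_wpM2r => //; apply: ler_wpM2l.
  have -> : ((k.+1)`!)%:R * (8 * q * (2 * q * P) * (2 * (r ^+ 2 * (h * D))) * 2^-1) =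
    D * P * 8^-1 * (((k.+1)`!)%:R * (16 * 8 * q ^+ 2) * r ^+ 2 * h) by field.
  by apply: ler_piMr => //; rewrite mulr_ge0 ?invr_ge0 // ltW.
have up1 : ((k.+1)`!)%:R * (\sum_(i in L) #|through H i|)%:R <= D * P * 8^-1.
  rewrite natr_sum mulr_sumr.
  apply: (@le_trans _ _ (\sum_(i in L) P * (16 * q * d))); first by apply: ler_sum.
  rewrite sumr_const -[X in X <= _]mulr_natl.
  apply: (@le_trans _ _ (32 * (r ^+ 2 * D) * (P * (16 * q * d)))).
    apply: ler_wpM2r => //; apply: mulr_ge0; first exact: ltW.
    by rewrite !mulr_ge0 // ltW.
  have -> : 32 * (r ^+ 2 * D) * (P * (16 * q * d)) = D * P * 8^-1 * (16 * 16 * 16 * q * r ^+ 2 * d) by field.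
  by apply: ler_piMr => //; rewrite mulr_ge0 ?invr_ge0 // ltW.
have : ((k.+1)`!)%:R * #|H|%:R <= D * P * 8^-1 + D * P * 8^-1.
  apply: (@le_trans _ _ (((k.+1)`!)%:R * (#|H0| + \sum_(i in L) #|through H i|)%:R)).
    by apply: ler_wpM2l => //; rewrite ler_nat.
  by rewrite natrD mulrDr; apply: lerD.
move: low DP0; clear; lra.
Qed.

End Descent.

(** * Descent on the number of vertices *)

(* All weights are at most [1 / spread_scale], so that the relative degree defect
   [4 r^4 / spread_scale] is [1 / (2^(k+12) r^2)], as [high_degree_absurd] requires. *)
Definition spread_scale (k : nat) : nat := 2 ^ (k + 14) * k.+2 ^ 6.

(** With [r = k.+2] and [h = 1 / t.-1], the first summand yields [r^2 h <= c^2] for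
    [c = 1 / spread_scale k], the second the smallness of [h] needed in [high_degree_absurd]. *)
Definition descent_bound (k : nat) : nat :=
  k.+2 ^ 2 * spread_scale k ^ 2 + (k.+1)`! * 2 ^ (2 * k + 7) * k.+2 ^ 2.

Lemma bin_del2_le t k : (1 < t)%N -> ('C(t - 2, k) <= 'C(t, k.+2))%N.
Proof.
case: t => [|[|m]] // _; rewrite !subSS subn0 binS [in X in (_ + X)%N]binS.
by rewrite addnA leq_addl.
Qed.

Section Finite.
Variables (R : rcfType) (T : finType).
Implicit Types (V : {set T}) (G : {set {set T}}) (w : T -> R) (i : T).

(** If every deletion fails, [degree_ge] holds at every vertex and [high_degree_absurd] applies. The
    inequality obtained says that restricting to [V :\ i] and rescaling by [1 / (1 - w i)] does not
    lower the weight. *)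
Lemma exists_deletion w V G k t :
  (descent_bound k <= t.-1)%N -> (t < #|V|)%N ->
  (forall i, 0 <= w i) -> \sum_(i in V) w i = 1 ->
  G \subset ksub V k.+2 -> (#|G| <= 'C(t, k.+2))%N ->
  'C(t.-1, k.+2)%:R / (t.-1)%:R ^+ k.+2 < wt w G ->
  exists2 i, i \in V & (w i < 1) && ((1 - w i) ^+ k.+2 * wt w G <= wt w (avoid G i)).
Proof.
move=> hb tn w0 wS GV cG lamG; apply/exists_inP/contraT; rewrite negb_exists_in.
move=> /forall_inP no; exfalso.
pose K := spread_scale k.
have K0 : (0 < K)%N by rewrite muln_gt0 !expn_gt0.
have K0' : 0 < K%:R :> R by rewrite ltr0n.
have b1 : (k.+2 ^ 2 * K ^ 2 <= t.-1)%N by apply: leq_trans hb; apply: leq_addr.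
have b2 : ((k.+1)`! * 2 ^ (2 * k + 7) * k.+2 ^ 2 <= t.-1)%N.
  by apply: leq_trans hb; apply: leq_addl.
have u0 : (0 < t.-1)%N by apply: leq_trans b1; rewrite muln_gt0 !expn_gt0 K0.
have ru : (k.+2 <= t.-1)%N.
  apply: leq_trans b1; rewrite -mulnA leq_pmulr // muln_gt0 expn_gt0 K0 //.
have t1 : (1 < t)%N by move: u0; rewrite -subn1 subn_gt0.
have u0' : 0 < (t.-1)%:R :> R by rewrite ltr0n.
pose h : R := (t.-1)%:R^-1.
have h0 : 0 < h by rewrite invr_gt0.
have scale m : (m <= t.-1)%N -> m%:R * h <= 1.
  by move=> mt; rewrite ler_pdivrMr // mul1r ler_nat.
have rh := scale _ ru.
have h1 : k.+2%:R ^+ 2 * K%:R ^+ 2 * h <= 1.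
  by have := scale _ b1; rewrite natrM natrX (natrX _ K).
have h2 : ((k.+1)`!)%:R * (2 ^ (2 * k + 7))%:R * k.+2%:R ^+ 2 * h <= 1.
  by have := scale _ b2; rewrite natrM [(_ * _)%:R]natrM [(k.+2 ^ 2)%:R]natrX.
pose c : R := K%:R^-1.
have c0 : 0 < c by rewrite invr_gt0.
have Kc : K%:R * c = 1 by rewrite divff // gt_eqF.
have c1 : c <= 1 by rewrite invf_le1 // ler1n.
have r2c2 : k.+2%:R ^+ 2 * h <= c ^+ 2.
  rewrite -(ler_pM2l (exprn_gt0 2 K0')) -exprMn Kc expr1n mulrA.
  by rewrite [X in X * h]mulrC.
have c2c : c ^+ 2 <= c by rewrite expr2 ler_piMl // ltW.
have r2c : k.+2%:R ^+ 2 * h <= c by apply: le_trans c2c.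
have r1 : 1 <= k.+2%:R :> R by rewrite ler1n.
pose d : R := 4 * k.+2%:R ^+ 4 * c.
have dE : (2 ^ (k + 12))%:R * k.+2%:R ^+ 2 * d = 1.
  rewrite -[RHS]Kc /d.
  have -> : K%:R = (2 ^ (k + 12))%:R * 4 * k.+2%:R ^+ 6 :> R.
    by rewrite /K /spread_scale (addnA k 12 2) expnD natrM (natrM _ _ (2 ^ 2)) (natrX _ k.+2).
  by move: (2 ^ _)%:R k.+2%:R => q r; ring.
have cd : c <= d.
  rewrite /d ler_peMl //; first exact: ltW.
  have : 1 <= k.+2%:R ^+ 4 :> R by apply: exprn_ege1.
  lra.
have d0 : 0 < d by apply: lt_le_trans cd.
have d1 : d <= 1.
  rewrite -dE ler_peMl //; first exact: ltW.
  by rewrite -[leLHS]mulr1 ler_pM // ?ler1n ?expn_gt0 // exprn_ege1.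
have rhd : k.+2%:R * h <= d.
  apply: le_trans cd; apply: le_trans r2c; rewrite expr2 -mulrA ler_peMl //.
  by rewrite mulr_ge0 // ltW.
have hf : fallp h k.+2 <= ((k.+2)`!)%:R * wt w G.
  have E := bin_fallp R u0 ru; rewrite -/h in E.
  have un0 : 0 < (t.-1)%:R ^+ k.+2 :> R by rewrite exprn_gt0.
  rewrite -(ler_pM2l un0) -E mulrCA ler_wpM2l //.
  by move: (ltW lamG); rewrite ler_pdivrMr // mulrC.
have hfe : fallp h k.+2 <= ((k.+2)`!)%:R * esym w V k.+2.
  by apply: le_trans hf _; rewrite ler_wpM2l // wt_sub.
(* The crude moment bound already caps every weight by [c], which is what the sharp moment bound
   requires. *)
have p2c : \sum_(i in V) w i ^+ 2 <= c ^+ 2.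
  by apply: le_trans r2c2; apply: p2_le hfe => //; exact: ltW.
have wc i : i \in V -> w i <= c.
  move=> iV; rewrite -(@ler_pXn2r _ 2) ?nnegrE //; last exact: ltW.
  apply: le_trans p2c; rewrite (bigD1 i iV) /= lerDl.
  by apply: sumr_ge0 => j _; rewrite sqr_ge0.
have c2 : c <= 2^-1.
  have K2 : (2 <= K)%N.
    rewrite /K /spread_scale -[X in (X <= _)%N]muln1 leq_mul ?expn_gt0 //.
    by rewrite -[X in (X <= _)%N]expn1 leq_exp2l // addnC.
  by rewrite /c lef_pV2 ?posrE // ler_nat.
have p2h : (\sum_(i in V) w i ^+ 2) * (1 - 2 * k.+2%:R ^+ 3 * c) <= h.
  apply: p2_sharp hfe => //; [exact: ltW|exact: le_trans r2c c2|exact: ltW].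
apply: (@high_degree_absurd _ _ w V G k t d h) => //.
- by rewrite dE.
- move=> i iV; apply: (@degree_ge _ _ w V G k i h c) => //.
  + exact: ltW.
  + exact: wc.
  + have := no i iV; rewrite negb_and -!ltNge -leNgt => /orP[|//].
    by move=> wi1; have wic := wc i iV; exfalso; lra.
Qed.

(** Induction on the number of vertices, one deletion per step, down to exactly [t]. *)
Lemma wt_le_complete k t V w G : (0 < k)%N ->
  (descent_bound k <= t.-1)%N -> (stable_bound k <= t - 2)%N -> (2 * k.+2 <= t)%N ->
  (t <= #|V|)%N -> (forall i, 0 <= w i) -> \sum_(i in V) w i = 1 ->
  G \subset ksub V k.+2 -> (#|G| <= 'C(t, k.+2) - 'C(t - 2, k))%N ->
  wt w G <= 'C(t.-1, k.+2)%:R / (t.-1)%:R ^+ k.+2.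
Proof.
move=> k0 hb hs h2; have [n] := ubnP #|V|.
elim: n => // n IH in V w G *; rewrite ltnS => Vn tV w0 wS GV cG.
have t1 : (1 < t)%N by apply: leq_trans h2.
have u0 : (0 < t.-1)%N by rewrite -subn1 subn_gt0.
have u0' : 0 < (t.-1)%:R :> R by rewrite ltr0n.
have un0 : 0 < (t.-1)%:R ^+ k.+2 :> R by rewrite exprn_gt0.
move: (tV); rewrite leq_eqVlt => /orP[/eqP tE|tlt].
  rewrite ler_pdivlMr // mulrC.
  (* Scaling to total [t.-1] meets the normalisation of [esym_sub_wt_le]. *)
  pose y i := (t.-1)%:R * w i.
  have -> : (t.-1)%:R ^+ k.+2 * wt w G = wt y G.
    by rewrite -wtZ // => e /(subsetP GV); rewrite mem_ksub => /andP[_ /eqP].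
  have -> : wt y G = esym y V k.+2 - wt y (ksub V k.+2 :\: G).
    by rewrite /esym (wt_setID y (ksub V k.+2) G) (setIidPr GV) addrK.
  have cH : (#|G| + #|ksub V k.+2 :\: G| = 'C(#|V|, k.+2))%N.
    by rewrite -card_ksub -(cardsID G (ksub V k.+2)) (setIidPr GV).
  rewrite tE; apply: esym_sub_wt_le => //; rewrite -?tE //.
  - by move=> i; rewrite mulr_ge0.
  - by rewrite -mulr_sumr wS mulr1.
  - exact: subsetDl.
  rewrite -(leq_add2l #|G|) cH -tE.
  by apply: leq_trans (leq_add cG (leqnn _)) _; rewrite subnK // bin_del2_le.
rewrite leNgt; apply/negP => lamG.
have cG' : (#|G| <= 'C(t, k.+2))%N by apply: leq_trans cG (leq_subr _ _).
have [i iV /andP[wi1 hdel]] := exists_deletion hb tlt w0 wS GV cG' lamG.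
pose s := 1 - w i; have s0 : 0 < s by rewrite subr_gt0.
pose w' j := s^-1 * w j.
have AV : avoid G i \subset ksub (V :\ i) k.+2.
  apply/subsetP => e; rewrite inE => /andP[/(subsetP GV)]; rewrite !mem_ksub subsetD1.
  by case/andP=> -> -> ->.
have AU e : e \in avoid G i -> #|e| = k.+2.
  by move/(subsetP AV); rewrite mem_ksub => /andP[_ /eqP].
have : wt w' (avoid G i) <= 'C(t.-1, k.+2)%:R / (t.-1)%:R ^+ k.+2.
  apply: (IH (V :\ i)) => //.
  - by apply: leq_trans Vn; rewrite [X in (_ <= X)%N](cardsD1 i) iV.
  - by move: tlt; rewrite (cardsD1 i) iV.
  - by move=> j; rewrite mulr_ge0 // invr_ge0 ltW.
  - rewrite -mulr_sumr; have : \sum_(j in V :\ i) w j = s.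
      by move: wS; rewrite (big_setD1 i iV) /= /s => <-; rewrite addrAC subrr add0r.
    by move=> ->; rewrite mulVf // gt_eqF.
  - apply: leq_trans cG; apply/subset_leq_card/subsetP => e.
    by rewrite inE => /andP[].
rewrite (wtZ _ _ AU); apply/negP; rewrite -ltNge.
apply: lt_le_trans lamG _.
by rewrite exprVn ler_pdivlMl ?exprn_gt0.
Qed.

End Finite.

From mathcomp Require Import finmap.
From mathcomp Require Import all_classical all_reals all_analysis.
Import numFieldNormedType.Exports.
Local Open Scope fset_scope.
Local Open Scope ring_scope.

(** * From finite types to finite sets of naturals *)

Section Transfer.
Implicit Types (e f : {fset nat}) (G : {fset {fset nat}}).

(** Elements of [e] from [n] on are dropped, so the lemmas on traces assume that [e] lies below
    [n]. *)
Definition ord_trace n e : {set 'I_n} := [set i : 'I_n | val i \in e].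

Definition ord_family n G : {set {set 'I_n}} :=
  [set A in [seq ord_trace n e | e <- enum_fset G]].

Lemma perm_bounded n e : (forall x, x \in e -> (x < n)%N) ->
  perm_eq (enum_fset e) [seq x <- iota 0 n | x \in e].
Proof.
move=> en; apply: uniq_perm; rewrite ?fset_uniq ?filter_uniq ?iota_uniq // => x.
rewrite mem_filter mem_iota /= add0n.
by apply/idP/andP => [xe|[]//]; split=> //; apply: en.
Qed.

Lemma ord_trace_big (R : Type) (idx : R) (op : Monoid.com_law idx) n e (F : nat -> R) :
  (forall x, x \in e -> (x < n)%N) ->
  \big[op/idx]_(x <- e) F x = \big[op/idx]_(i in ord_trace n e) F (val i).
Proof.
move=> en; rewrite (perm_big _ (perm_bounded en)) big_filter /=.
under [RHS]eq_bigl => i do rewrite inE.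
have -> : iota 0 n = index_iota 0 n by rewrite /index_iota subn0.
by rewrite big_mkord.
Qed.

Lemma card_ord_trace n e : (forall x, x \in e -> (x < n)%N) -> #|ord_trace n e| = #|` e|.
Proof. by move=> en; rewrite -sum1_card -(ord_trace_big _ (fun=> 1%N) en) sum1_size. Qed.

Lemma ord_trace_inj n e f : (forall x, x \in e -> (x < n)%N) ->
  (forall x, x \in f -> (x < n)%N) -> ord_trace n e = ord_trace n f -> e = f.
Proof.
move=> en fn ef; apply/fsetP => x; have [xn|nx] := ltnP x n.
  by have /setP/(_ (Ordinal xn)) := ef; rewrite !inE.
apply/idP/idP => [/en|/fn]; by rewrite ltnNge nx.
Qed.

Lemma ord_family_uniq n G : (forall e, e \in G -> forall x, x \in e -> (x < n)%N) ->
  uniq [seq ord_trace n e | e <- enum_fset G].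
Proof.
move=> Gn; rewrite map_inj_in_uniq ?fset_uniq // => e f eG fG.
by apply: ord_trace_inj; apply: Gn.
Qed.

Lemma card_ord_family n G : (forall e, e \in G -> forall x, x \in e -> (x < n)%N) ->
  #|ord_family n G| = #|` G|.
Proof. by move=> Gn; rewrite cardsE (card_uniqP (ord_family_uniq Gn)) size_map. Qed.

Lemma wgraph_ord_family (R : realType) (w : nat -> R) n G :
  (forall e, e \in G -> forall x, x \in e -> (x < n)%N) ->
  wgraph w G = wt (fun i : 'I_n => w (val i)) (ord_family n G).
Proof.
move=> Gn; rewrite /wt big_set -big_uniq ?ord_family_uniq //= big_map /wgraph.
rewrite big_seq [RHS]big_seq; apply: eq_bigr => e eG.
by apply: (ord_trace_big _ w); apply: Gn.
Qed.

Lemma ord_family_ksub n r G : is_rgraph r G ->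
  (forall e, e \in G -> forall x, x \in e -> (x < n)%N) ->
  ord_family n G \subset ksub [set: 'I_n] r.
Proof.
move=> Gr Gn; apply/fintype.subsetP => A; rewrite inE => /mapP[e eG ->].
by rewrite mem_ksub finset.subsetT (card_ord_trace (Gn e eG)) (Gr e eG) eqxx.
Qed.

Lemma exists_bound G : exists n, forall e, e \in G -> forall x, x \in e -> (x < n)%N.
Proof.
exists (\max_(e <- G) \max_(x <- e) x)%N.+1 => e eG x xe; rewrite ltnS.
apply: leq_trans (@leq_bigmax_seq _ (enum_fset G) xpredT
  (fun e : {fset nat} => (\max_(x <- e) x)%N) e eG isT).
exact: (@leq_bigmax_seq _ (enum_fset e) xpredT (fun x => x) x xe isT).
Qed.

(** * Weightings of the naturals and the Lagrangian *)

Lemma weighting_series_le1 (R : realType) (w : nat -> R) n : weighting w ->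
  \sum_(i < n) w (val i) <= 1.
Proof.
case=> w0 w1; rewrite -(big_mkord xpredT w).
have cw : cvgn (series w) by apply: cvgP w1.
have nd : nondecreasing_seq (series w) by apply: nondecreasing_series => *.
have := nondecreasing_cvgn_le nd cw n.
by rewrite (cvg_lim _ w1).
Qed.

Lemma weighting_le1 (R : realType) (w : nat -> R) x : weighting w -> w x <= 1.
Proof.
move=> ww; apply: le_trans (weighting_series_le1 x.+1 ww).
rewrite (bigD1 ord_max) //= lerDl; apply: sumr_ge0 => i _; exact: ww.1.
Qed.

(** The vertex 0 receives no weight because the complete graph uses the labels from 1 on. *)
Definition uniform_weight (R : realType) t (x : nat) : R :=
  if (0 < x < t)%N then (t.-1)%:R^-1 else 0.

Lemma weighting_uniform (R : realType) t : (1 < t)%N -> weighting (uniform_weight R t).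
Proof.
move=> t1; split.
  by move=> x; rewrite /uniform_weight; case: ifP => // _; rewrite invr_ge0.
apply: cvg_near_cst; exists t => // N /= tN.
have tail0 : \sum_(t <= x < N) uniform_weight R t x = 0.
  rewrite big_nat_cond big1 // => x; rewrite andbT => /andP[tx _].
  by rewrite /uniform_weight [(x < t)%N]ltnNge tx andbF.
have t0 : (0 < t)%N by apply: ltnW.
rewrite /series /= (@big_cat_nat _ _ _ t 0 N) //= tail0 addr0.
rewrite big_ltn // {1}/uniform_weight /= add0r.
rewrite (eq_big_nat _ _ (F2 := fun=> (t.-1)%:R^-1)); last first.
  by move=> x xt; rewrite /uniform_weight xt.
rewrite sumr_const_nat subn1 -(mulr_natl (t.-1)%:R^-1) divff //.
by rewrite pnatr_eq0 -lt0n -subn1 subn_gt0.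
Qed.

Lemma complete_rgraphP n r e :
  reflect (#|` e| = r /\ forall x, x \in e -> (0 < x < n.+1)%N) (e \in complete_rgraph n r).
Proof.
rewrite !inE /= fpowersetE; apply: (iffP andP) => [[/fsubsetP en /eqP er]|[er en]]; split.
- by [].
- by move=> x /en; rewrite !inE /= mem_iota add1n.
- by apply/fsubsetP => x /en xn; rewrite !inE /= mem_iota add1n.
- exact/eqP.
Qed.

Lemma card_complete_rgraph_ge n r : ('C(n, r) <= #|` complete_rgraph n r|)%N.
Proof.
have Kn e : e \in complete_rgraph n r -> forall x, x \in e -> (x < n.+1)%N.
  by case/complete_rgraphP => _ en x /en /andP[].
rewrite -(card_ord_family Kn).
have -> : n = #|[set~ (ord0 : 'I_n.+1)]| by rewrite cardsC1 card_ord.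
rewrite -card_ksub cardsC1 card_ord /=.
apply/subset_leq_card/fintype.subsetP => A; rewrite mem_ksub => /andP[A0 /eqP cA].
pose e := [fset val i | i in A].
have memA i : (val i \in e) = (i \in A).
  apply/imfsetP/idP => [[j /= jA /val_inj ->] //|iA]; by exists i.
have eA : ord_trace n.+1 e = A by apply/setP => i; rewrite inE memA.
have en x : x \in e -> (0 < x < n.+1)%N.
  case/imfsetP => i /= iA ->; rewrite ltn_ord andbT.
  have := fintype.subsetP A0 _ iA; rewrite !inE => i0; rewrite lt0n.
  by apply: contra i0 => /eqP i0; apply/eqP/val_inj.
have en' x : x \in e -> (x < n.+1)%N by move/en/andP => [].
rewrite inE; apply/mapP; exists e => //; apply/complete_rgraphP; split=> //.
by rewrite -(card_ord_trace en') eA.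
Qed.

Lemma wgraph_uniform_complete (R : realType) t r : (0 < t)%N ->
  wgraph (uniform_weight R t) (complete_rgraph t.-1 r) =
  #|` complete_rgraph t.-1 r|%:R / (t.-1)%:R ^+ r.
Proof.
move=> t0; rewrite /wgraph big_seq (eq_bigr (fun=> (t.-1)%:R ^- r)); last first.
  move=> e /complete_rgraphP[<- en]; rewrite big_seq.
  rewrite (eq_bigr (fun=> (t.-1)%:R^-1)); last first.
    by move=> x /en; rewrite prednK // /uniform_weight => ->.
  by rewrite -big_seq big_const_seq count_predT iter_mulr_1 exprVn.
by rewrite -big_seq big_const_seq count_predT iter_addr_0 -[LHS]mulr_natl.
Qed.

Lemma lagrangian_complete_ge (R : realType) t r : (1 < t)%N ->
  'C(t.-1, r)%:R / (t.-1)%:R ^+ r <= lagrangian R (complete_rgraph t.-1 r).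
Proof.
move=> t1; apply: (@le_trans _ _ (wgraph (uniform_weight R t) (complete_rgraph t.-1 r))).
  rewrite wgraph_uniform_complete ?(ltnW t1) // ler_wpM2r ?invr_ge0 ?exprn_ge0 //.
  by rewrite ler_nat card_complete_rgraph_ge.
apply: ub_le_sup; last by exists (uniform_weight R t) => //; apply: weighting_uniform.
(* The supremum requires an upper bound: all weights are at most 1, so the number of edges is
   one. *)
exists #|` complete_rgraph t.-1 r|%:R => _ [w /= ww <-].
rewrite /wgraph -sum1_size natr_sum; apply: ler_sum => e _.
apply: Num.Theory.prodr_ile1 => x _; rewrite ww.1 /=; exact: weighting_le1.
Qed.

Lemma lagrangian_le (R : realType) G (c : R) :
  (forall w, weighting w -> wgraph w G <= c) -> lagrangian R G <= c.
Proof.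
move=> h; apply: ge_sup; last by move=> _ [w /= ww <-]; apply: h.
(* The supremum requires a nonempty set; the point mass at 1, [uniform_weight R 2], provides an
   element. *)
exists (wgraph (uniform_weight R 2) G); exists (uniform_weight R 2) => //.
exact: weighting_uniform.
Qed.

Lemma wgraph_le_complete (R : realType) k t G (w : nat -> R) : (0 < k)%N ->
  (descent_bound k <= t.-1)%N -> (stable_bound k <= t - 2)%N -> (2 * k.+2 <= t)%N ->
  is_rgraph k.+2 G -> (#|` G| <= 'C(t, k.+2) - 'C(t - 2, k))%N -> weighting w ->
  wgraph w G <= 'C(t.-1, k.+2)%:R / (t.-1)%:R ^+ k.+2.
Proof.
move=> k0 hb hs h2 Gr cG ww; have [n0 Gn0] := exists_bound G.
(* Adding [t] ensures at least [t] vertices, as [wt_le_complete] requires. *)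
pose n := (n0 + t)%N.
have Gn e : e \in G -> forall x, x \in e -> (x < n)%N.
  by move=> eG x xe; apply: leq_trans (Gn0 e eG x xe) (leq_addr _ _).
rewrite (wgraph_ord_family w Gn).
have c0 : 0 <= 'C(t.-1, k.+2)%:R / (t.-1)%:R ^+ k.+2 :> R.
  by rewrite divr_ge0 // exprn_ge0.
have wn0 (i : 'I_n) : 0 <= w (val i) by apply: ww.1.
have s1 := weighting_series_le1 n ww.
set s := \sum_(i < n) w (val i) in s1.
have GK := ord_family_ksub Gr Gn.
have Gk A : A \in ord_family n G -> #|A| = k.+2.
  by move/(fintype.subsetP GK); rewrite mem_ksub => /andP[_ /eqP].
have s0 : 0 <= s by apply: sumr_ge0.
(* The total weight [s] below [n] may be less than 1. A zero total makes every edge weigh nothing; a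
   positive one is rescaled to 1, and the factor [s ^+ k.+2 <= 1] only helps. *)
have [sz|sn] := eqVneq s 0.
  have wz (i : 'I_n) : w (val i) = 0.
    apply/eqP; rewrite eq_le wn0 andbT -sz /s (bigD1 i) //= lerDl.
    by apply: sumr_ge0 => j _; apply: wn0.
  rewrite /wt big1 // => A /Gk cA.
  have /card_gt0P[i iA] : (0 < #|A|)%N by rewrite cA.
  by rewrite (bigD1 i iA) /= wz mul0r.
have sp : 0 < s by rewrite lt_neqAle eq_sym sn.
have -> : wt (fun i : 'I_n => w (val i)) (ord_family n G) =
          s ^+ k.+2 * wt (fun i : 'I_n => s^-1 * w (val i)) (ord_family n G).
  by rewrite (wtZ _ _ Gk) exprVn mulVKf // expf_neq0.
apply: (@le_trans _ _ (s ^+ k.+2 * ('C(t.-1, k.+2)%:R / (t.-1)%:R ^+ k.+2))); last first.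
  by rewrite ler_piMl // exprn_ile1.
rewrite ler_wpM2l ?exprn_ge0 //; apply: (wt_le_complete k0 hb hs h2 (V := [set: 'I_n])) => //.
- by rewrite cardsT card_ord leq_addl.
- by move=> i; rewrite mulr_ge0 // invr_ge0.
- rewrite -mulr_sumr (eq_bigl xpredT); last by move=> i; rewrite inE.
  by rewrite mulVf.
- by rewrite card_ord_family.
Qed.

End Transfer.

Theorem theorem5p1 (r : nat) : (3 <= r)%N ->
  exists t0 : nat, forall t : nat, (t0 <= t)%N ->
    forall (R : realType) (G : {fset {fset nat}}),
      is_rgraph r G ->
      #|` G| = ('C(t, r) - 'C(t - 2, r - 2))%N ->
      lagrangian R G <= lagrangian R (complete_rgraph t.-1 r).
Proof.
case: r => [|[|k]] // k0; rewrite !ltnS in k0.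
(* The summands are the thresholds of the descent, of the case of [t] vertices and of [bin_slack];
   the final 2 covers the shifts to [t.-1] and [t - 2]. *)
exists (descent_bound k + stable_bound k + 2 * k.+2 + 2)%N => t ht R G Gr cG.
have [h1 h2 h3 h4] : [/\ descent_bound k <= t.-1, stable_bound k <= t - 2,
                        2 * k.+2 <= t & 1 < t]%N.
  by move: (descent_bound k) (stable_bound k) ht => a b ht; split; lia.
apply: le_trans (lagrangian_complete_ge _ _ h4); apply: lagrangian_le => w ww.
by apply: wgraph_le_complete => //; rewrite cG !subSS subn0.
Qed.
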